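(* Let $n\geq 1$ be an integer, let $k$ be an algebraically closed field, and let $\mathcal{C}_{A_\infty}^n$ be the $n$-cluster category of type $A_\infty$ over $k$, that is, a $k$-linear algebraic triangulated category which is idempotent complete and classically generated by an $(n+1)$-spherical object. Then its Grothendieck group satisfies $$K_0(\mathcal{C}_{A_\infty}^n)\cong \mathbb{Z}$$ as abelian groups.
   Context: Let $k$ be an algebraically closed field and $n\geq 1$ an integer. An object $s$ of a $k$-linear triangulated category $\mathcal{C}$ with suspension functor $\Sigma$ is called $(n+1)$-spherical if $$\dim_k \mathrm{Hom}_{\mathcal{C}}(s,\Sigma^{\ell}s)=\begin{cases}1 & \text{if } \ell=0 \text{ or } \ell=n+1,\\ 0 & \text{for all other integers } \ell.\end{cases}$$ The category $\mathcal{C}$ is classically generated by $s$ if the smallest full triangulated subcategory of $\mathcal{C}$ containing $s$ and closed under isomorphisms and direct summands is $\mathcal{C}$ itself. A triangulated category is algebraic if it is triangle equivalent to the stable category of a Frobenius exact category. The $n$-cluster category of type $A_\infty$, denoted $\mathcal{C}_{A_\infty}^n$, is the $k$-linear algebraic triangulated category that is idempotent complete and classically generated by an $(n+1)$-spherical object; it is known to be uniquely determined by these properties, up to triangulated equivalence. It is Hom-finite and Krull–Schmidt. Grothendieck group: for a triangulated category $\mathcal{C}$ with suspension $\Sigma$, let $F$ be the free abelian group on the isomorphism classes $[X]$ of objects $X$ of $\mathcal{C}$. The split Grothendieck group is $$K_0^{\mathrm{sp}}(\mathcal{C})=F/\langle [X\oplus Y]-[X]-[Y] \mid X,Y\in\mathcal{C}\rangle,$$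 and the Grothendieck group is $$K_0(\mathcal{C})=K_0^{\mathrm{sp}}(\mathcal{C})/\langle [X]-[Y]+[Z] \mid X\to Y\to Z\to\Sigma X \text{ is a (distinguished) triangle in } \mathcal{C}\rangle.$$ *)

(* Defs.v *)
From HB Require Import structures.
From mathcomp Require Import all_boot all_algebra.
From mathcomp Require Import boolp.
From mathcomp.multinomials Require Import freeg.

Set Implicit Arguments.
Unset Strict Implicit.
Unset Printing Implicit Defensive.

Import GRing.Theory.
Local Open Scope ring_scope.
Local Open Scope quotient_scope.

Record preadditive := Preadditive {
  Ob :> Type;
  Hom : Ob -> Ob -> zmodType;
  idm : forall X, Hom X X;
  comp : forall X Y Z, Hom Y Z -> Hom X Y -> Hom X Z;
  comp_idl : forall X Y (f : Hom X Y), comp (idm Y) f = f;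
  comp_idr : forall X Y (f : Hom X Y), comp f (idm X) = f;
  comp_assoc : forall X Y Z W (h : Hom Z W) (g : Hom Y Z) (f : Hom X Y),
    comp h (comp g f) = comp (comp h g) f;
  comp_addl : forall X Y Z (g g' : Hom Y Z) (f : Hom X Y),
    comp (g + g') f = comp g f + comp g' f;
  comp_addr : forall X Y Z (g : Hom Y Z) (f f' : Hom X Y),
    comp g (f + f') = comp g f + comp g f'
}.

Arguments idm {_} X.
Arguments comp {_ X Y Z} g f.

Declare Scope cat_scope.
Delimit Scope cat_scope with cat.
Notation "g \oc f" := (comp g f) (at level 40, left associativity) : cat_scope.
Local Open Scope cat_scope.

Section Preadditive.
Variable C : preadditive.
Implicit Types X Y Z S : C.

Definition is_iso X Y (f : Hom X Y) : Prop :=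
  exists g : Hom Y X, g \oc f = idm X /\ f \oc g = idm Y.

Definition isomorphic X Y : Prop := exists f : Hom X Y, is_iso f.

Definition is_zero Z : Prop := idm Z = 0.

Definition biproduct X Y S : Prop :=
  exists (i1 : Hom X S) (i2 : Hom Y S) (p1 : Hom S X) (p2 : Hom S Y),
    [/\ p1 \oc i1 = idm X, p2 \oc i2 = idm Y,
        p2 \oc i1 = 0, p1 \oc i2 = 0 &
        i1 \oc p1 + i2 \oc p2 = idm S].

Definition additive_category : Prop :=
  (exists Z, is_zero Z) /\ (forall X Y, exists S, biproduct X Y S).

Definition idempotent_complete : Prop :=
  forall X (e : Hom X X), e \oc e = e ->
    exists (Y : C) (r : Hom X Y) (i : Hom Y X),
      i \oc r = e /\ r \oc i = idm Y.

Definition is_kernel X Y Z (i : Hom X Y) (p : Hom Y Z) : Prop :=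
  p \oc i = 0 /\
  forall T (f : Hom T Y), p \oc f = 0 -> exists! g : Hom T X, i \oc g = f.

Definition is_cokernel X Y Z (i : Hom X Y) (p : Hom Y Z) : Prop :=
  p \oc i = 0 /\
  forall T (f : Hom Y T), f \oc i = 0 -> exists! g : Hom Z T, g \oc p = f.

Definition is_pushout X Y X' Y' (i : Hom X Y) (f : Hom X X')
    (i' : Hom X' Y') (f' : Hom Y Y') : Prop :=
  i' \oc f = f' \oc i /\
  forall T (u : Hom Y T) (v : Hom X' T), u \oc i = v \oc f ->
    exists! w : Hom Y' T, w \oc f' = u /\ w \oc i' = v.

Definition is_pullback Y Z Y' Z' (p : Hom Y Z) (f : Hom Z' Z)
    (p' : Hom Y' Z') (f' : Hom Y' Y) : Prop :=
  f \oc p' = p \oc f' /\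
  forall T (u : Hom T Y) (v : Hom T Z'), p \oc u = f \oc v ->
    exists! w : Hom T Y', f' \oc w = u /\ p' \oc w = v.

End Preadditive.

Record functor (C D : preadditive) := Functor {
  fob :> C -> D;
  fmap : forall X Y, {additive Hom X Y -> Hom (fob X) (fob Y)};
  fmap_id : forall X, fmap X X (idm X) = idm (fob X);
  fmap_comp : forall X Y Z (g : Hom Y Z) (f : Hom X Y),
    fmap X Z (g \oc f) = fmap Y Z g \oc fmap X Y f
}.

Arguments fmap {C D} F {X Y} : rename.

#[local] Obligation Tactic := idtac.

Program Definition idF (C : preadditive) : functor C C :=
  @Functor C C id (fun X Y => idfun) _ _.
Next Obligation. by []. Qed.
Next Obligation. by []. Qed.

Program Definition compF (C D E : preadditive) (G : functor D E)
    (F : functor C D) : functor C E :=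
  @Functor C E (G \o F) (fun X Y => fmap G \o fmap F) _ _.
Next Obligation. by move=> C D E G F X /=; rewrite !fmap_id. Qed.
Next Obligation. by move=> C D E G F X Y Z g f /=; rewrite !fmap_comp. Qed.

Record nat_iso (C D : preadditive) (F G : functor C D) := NatIso {
  ncomp :> forall X, Hom (F X) (G X);
  ncomp_iso : forall X, is_iso (ncomp X);
  ncomp_nat : forall X Y (f : Hom X Y),
    ncomp Y \oc fmap F f = fmap G f \oc ncomp X
}.

Record quasi_inverse (C D : preadditive) (F : functor C D) := QuasiInverse {
  qinv :> functor D C;
  qinv_counit : nat_iso (compF F qinv) (idF D);
  qinv_unit : nat_iso (compF qinv F) (idF C)
}.

Definition is_equivalence (C D : preadditive) (F : functor C D) : Prop :=
  inhabited (quasi_inverse F).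

(* A suspension endofunctor together with a class of candidate triangles
   X -f-> Y -g-> Z -h-> Sigma X, not subject to any axiom. *)
Record tri_data (C : preadditive) := TriData {
  susp : functor C C;
  dist : forall X Y Z, Hom X Y -> Hom Y Z -> Hom Z (susp X) -> Prop
}.

Arguments dist {C} t {X Y Z} f g h.

(* The suspension is an autoequivalence, with a chosen quasi-inverse that
   gives a meaning to its negative powers. *)
Record triangulated (C : preadditive) := Triangulated {
  tri_of :> tri_data C;
  desusp : quasi_inverse (susp tri_of);
  tr_additive : additive_category C;
  tr1_iso : forall X Y Z X' Y' Z'
    (f : Hom X Y) (g : Hom Y Z) (h : Hom Z (susp tri_of X))
    (f' : Hom X' Y') (g' : Hom Y' Z') (h' : Hom Z' (susp tri_of X'))
    (a : Hom X X') (b : Hom Y Y') (c : Hom Z Z'),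
    dist tri_of f g h -> is_iso a -> is_iso b -> is_iso c ->
    b \oc f = f' \oc a -> c \oc g = g' \oc b ->
    fmap (susp tri_of) a \oc h = h' \oc c ->
    dist tri_of f' g' h';
  tr1_id : forall X Z, is_zero Z ->
    dist tri_of (idm X) (0 : Hom X Z) (0 : Hom Z (susp tri_of X));
  tr1_cone : forall X Y (f : Hom X Y),
    exists Z (g : Hom Y Z) (h : Hom Z (susp tri_of X)), dist tri_of f g h;
  tr2 : forall X Y Z (f : Hom X Y) (g : Hom Y Z) (h : Hom Z (susp tri_of X)),
    dist tri_of f g h <-> dist tri_of g h (- fmap (susp tri_of) f);
  tr3 : forall X Y Z X' Y' Z'
    (f : Hom X Y) (g : Hom Y Z) (h : Hom Z (susp tri_of X))
    (f' : Hom X' Y') (g' : Hom Y' Z') (h' : Hom Z' (susp tri_of X'))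
    (a : Hom X X') (b : Hom Y Y'),
    dist tri_of f g h -> dist tri_of f' g' h' -> b \oc f = f' \oc a ->
    exists c : Hom Z Z',
      c \oc g = g' \oc b /\ fmap (susp tri_of) a \oc h = h' \oc c;
  tr4 : forall X Y Z Z' X' Y' (f : Hom X Y) (g : Hom Y Z)
    (u : Hom Y Z') (u' : Hom Z' (susp tri_of X))
    (v : Hom Z X') (v' : Hom X' (susp tri_of Y))
    (w : Hom Z Y') (w' : Hom Y' (susp tri_of X)),
    dist tri_of f u u' -> dist tri_of g v v' -> dist tri_of (g \oc f) w w' ->
    exists (a : Hom Z' Y') (b : Hom Y' X'),
      [/\ dist tri_of a b (fmap (susp tri_of) u \oc v'),
          a \oc u = w \oc g, w' \oc a = u', b \oc w = v &
          v' \oc b = fmap (susp tri_of) f \oc w']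
}.

(* F : C -> D is a triangle functor with respect to some natural isomorphism
   F Sigma -> Sigma F, and an equivalence of categories. *)
Definition triangle_equivalence (C D : preadditive) (TC : tri_data C)
    (TD : tri_data D) (F : functor C D) : Prop :=
  is_equivalence F /\
  exists eta : nat_iso (compF F (susp TC)) (compF (susp TD) F),
    forall X Y Z (f : Hom X Y) (g : Hom Y Z) (h : Hom Z (susp TC X)),
      dist TC f g h -> dist TD (fmap F f) (fmap F g) (eta X \oc fmap F h).

Section Triangulated.
Variables (C : preadditive) (T : triangulated C).

Definition susp_pow (l : int) (X : C) : C :=
  match l with
  | Posz m => iter m (susp T) X
  | Negz m => iter m.+1 (desusp T) X
  end.

(* Strictly full triangulated subcategories closed under direct summands. *)
Record thick (P : C -> Prop) : Prop := Thick {
  thick_zero : forall Z, is_zero Z -> P Z;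
  thick_susp : forall X, P X -> P (susp T X);
  thick_desusp : forall X, P X -> P (desusp T X);
  thick_cone : forall X Y Z (f : Hom X Y) (g : Hom Y Z) (h : Hom Z (susp T X)),
    dist T f g h -> P X -> P Y -> P Z;
  thick_iso : forall X Y, isomorphic X Y -> P X -> P Y;
  thick_summand : forall X Y S, biproduct X Y S -> P S -> P X
}.

Definition thick_closure (s X : C) : Prop :=
  forall P, thick P -> P s -> P X.

Definition classically_generated (s : C) : Prop :=
  forall X, thick_closure s X.

End Triangulated.

Section GeneratedSubgroup.
Variables (V : zmodType) (S : V -> Prop).

Definition gen_subgroup : {pred V} := fun x =>
  `[< forall H : V -> Prop, H 0 -> (forall y z, H y -> H z -> H (y - z)) ->
      (forall y, S y -> H y) -> H x >].

Lemma gen_subgroupP x :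
  reflect (forall H : V -> Prop, H 0 -> (forall y z, H y -> H z -> H (y - z)) ->
      (forall y, S y -> H y) -> H x) (x \in gen_subgroup).
Proof. exact: asboolP. Qed.

Lemma gen_subgroup_closed : zmod_closed gen_subgroup.
Proof.
split; first exact/gen_subgroupP.
move=> x y /gen_subgroupP Hx /gen_subgroupP Hy; apply/gen_subgroupP => H H0 HB HS.
exact: HB (Hx H H0 HB HS) (Hy H H0 HB HS).
Qed.

HB.instance Definition _ :=
  GRing.isZmodClosed.Build V gen_subgroup gen_subgroup_closed.

Definition quotient_by : zmodType := Quotient.quot gen_subgroup.

Definition quotient_pi (x : V) : quotient_by := \pi_(Quotient.quot gen_subgroup) x.

End GeneratedSubgroup.

Section Grothendieck.
Variable C : preadditive.

Definition isob (X Y : {classic (Ob C)}) : bool := `[< @isomorphic C X Y >].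

Lemma isob_equiv : equiv_class_of isob.
Proof.
split=> [X|X Y|Y X Z].
- apply/asboolP; exists (idm (X : C)), (idm (X : C)).
  by rewrite comp_idl.
- suff {X Y} sym (X Y : {classic (Ob C)}) : isob X Y -> isob Y X.
    by apply/idP/idP; exact: sym.
  move=> /asboolP[f [g [gf fg]]]; apply/asboolP.
  by exists g, f.
- move=> /asboolP[f [f' [f'f ff']]] /asboolP[g [g' [g'g gg']]].
  apply/asboolP; exists (g \oc f), (f' \oc g'); split.
    by rewrite comp_assoc -(comp_assoc f') g'g comp_idr.
  by rewrite comp_assoc -(comp_assoc g) ff' comp_idr.
Qed.

Canonical isob_equiv_rel := EquivRelPack isob_equiv.
Canonical isob_encModRel := defaultEncModRel isob.

Definition iso_class := {eq_quot isob}.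
HB.instance Definition _ := Choice.on iso_class.

Definition class_of (X : C) : iso_class := \pi_{eq_quot isob} (X : {classic (Ob C)}).

Definition F_iso : zmodType := {freeg iso_class / int}.

Definition free_class (X : C) : F_iso := Freeg [:: (1 : int, class_of X)].

Definition K0sp : zmodType :=
  quotient_by (fun x : F_iso => exists X Y S : C,
    biproduct X Y S /\ x = free_class S - free_class X - free_class Y).

Definition K0sp_class (X : C) : K0sp := quotient_pi _ (free_class X).

Definition K0 (T : tri_data C) : zmodType :=
  quotient_by (fun x : K0sp =>
    exists (X Y Z : C) (f : Hom X Y) (g : Hom Y Z) (h : Hom Z (susp T X)),
      dist T f g h /\ x = K0sp_class X - K0sp_class Y + K0sp_class Z).

End Grothendieck.

Section Exact.
Variable E : preadditive.

Definition kernel_cokernel X Y Z (i : Hom X Y) (p : @Hom E Y Z) : Prop :=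
  is_kernel i p /\ is_cokernel i p.

Section Admissible.
Variable confl : forall X Y Z, Hom X Y -> @Hom E Y Z -> Prop.

Definition adm_mono X Y (i : Hom X Y) : Prop :=
  exists Z (p : Hom Y Z), confl i p.

Definition adm_epi Y Z (p : Hom Y Z) : Prop :=
  exists X (i : Hom X Y), confl i p.

Definition injective_object (I : E) : Prop :=
  forall X Y (i : Hom X Y), adm_mono i ->
    forall f : Hom X I, exists g : Hom Y I, g \oc i = f.

Definition projective_object (P : E) : Prop :=
  forall Y Z (p : Hom Y Z), adm_epi p ->
    forall f : Hom P Z, exists g : Hom P Y, p \oc g = f.

(* Quillen's axioms in the formulation of Keller and Buehler. *)
Record exact_axioms : Prop := ExactAxioms {
  ex_additive : additive_category E;
  ex_kercoker : forall X Y Z (i : Hom X Y) (p : Hom Y Z),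
    confl i p -> kernel_cokernel i p;
  ex_iso : forall X Y Z X' Y' Z' (i : Hom X Y) (p : Hom Y Z)
    (i' : Hom X' Y') (p' : Hom Y' Z')
    (a : Hom X X') (b : Hom Y Y') (c : Hom Z Z'),
    confl i p -> is_iso a -> is_iso b -> is_iso c ->
    b \oc i = i' \oc a -> c \oc p = p' \oc b -> confl i' p';
  ex_mono_id : forall X, adm_mono (idm X);
  ex_epi_id : forall X, adm_epi (idm X);
  ex_mono_comp : forall X Y Z (i : Hom X Y) (j : Hom Y Z),
    adm_mono i -> adm_mono j -> adm_mono (j \oc i);
  ex_epi_comp : forall X Y Z (p : Hom X Y) (q : Hom Y Z),
    adm_epi p -> adm_epi q -> adm_epi (q \oc p);
  ex_pushout : forall X Y X' (i : Hom X Y) (f : Hom X X'), adm_mono i ->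
    exists Y' (i' : Hom X' Y') (f' : Hom Y Y'),
      is_pushout i f i' f' /\ adm_mono i';
  ex_pullback : forall Y Z Z' (p : Hom Y Z) (f : Hom Z' Z), adm_epi p ->
    exists Y' (p' : Hom Y' Z') (f' : Hom Y' Y),
      is_pullback p f p' f' /\ adm_epi p'
}.

Definition enough_injectives : Prop :=
  forall X, exists I (i : Hom X I), adm_mono i /\ injective_object I.

Definition enough_projectives : Prop :=
  forall X, exists P (p : Hom P X), adm_epi p /\ projective_object P.

End Admissible.
End Exact.

Record frobenius := Frobenius {
  fr_cat :> preadditive;
  confl : forall X Y Z, Hom X Y -> @Hom fr_cat Y Z -> Prop;
  fr_exact : exact_axioms confl;
  fr_enough_inj : enough_injectives confl;
  fr_enough_proj : enough_projectives confl;
  fr_proj_inj : forall X : fr_cat,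
    projective_object confl X <-> injective_object confl X
}.

Section CompTheory.
Variable C : preadditive.
Implicit Types X Y Z : C.

Lemma comp0l X Y Z (f : Hom X Y) : (0 : Hom Y Z) \oc f = 0.
Proof. by apply: (addrI (0 \oc f)); rewrite -comp_addl !addr0. Qed.

Lemma comp0r X Y Z (g : Hom Y Z) : g \oc (0 : Hom X Y) = 0.
Proof. by apply: (addrI (g \oc 0)); rewrite -comp_addr !addr0. Qed.

Lemma compNl X Y Z (g : Hom Y Z) (f : Hom X Y) : (- g) \oc f = - (g \oc f).
Proof. by apply: (addrI (g \oc f)); rewrite -comp_addl !subrr comp0l. Qed.

Lemma compNr X Y Z (g : Hom Y Z) (f : Hom X Y) : g \oc (- f) = - (g \oc f).
Proof. by apply: (addrI (g \oc f)); rewrite -comp_addr !subrr comp0r. Qed.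

Lemma compBl X Y Z (g g' : Hom Y Z) (f : Hom X Y) :
  (g - g') \oc f = g \oc f - g' \oc f.
Proof. by rewrite comp_addl compNl. Qed.

Lemma compBr X Y Z (g : Hom Y Z) (f f' : Hom X Y) :
  g \oc (f - f') = g \oc f - g \oc f'.
Proof. by rewrite comp_addr compNr. Qed.

Lemma cokernel_epi X Y Z T (i : Hom X Y) (p : Hom Y Z) (f g : Hom Z T) :
  is_cokernel i p -> f \oc p = g \oc p -> f = g.
Proof.
case=> pi0 univ e.
have fpi : (f \oc p) \oc i = 0 by rewrite -comp_assoc pi0 comp0r.
have [h [_ uniq_h]] := univ _ _ fpi.
by rewrite -(uniq_h f) // -(uniq_h g).
Qed.

End CompTheory.

Section Stable.
Variable E : frobenius.
Implicit Types X Y Z : E.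

Definition factors_inj X Y (f : Hom X Y) : Prop :=
  exists I (a : Hom X I) (b : Hom I Y),
    injective_object (@confl E) I /\ f = b \oc a.

Lemma biproduct_injective I J S : biproduct I J S ->
  injective_object (@confl E) I -> injective_object (@confl E) J ->
  injective_object (@confl E) S.
Proof.
move=> [i1 [i2 [p1 [p2 [_ _ _ _ e]]]]] hI hJ X Y i hi f.
have [g1 e1] := hI _ _ _ hi (p1 \oc f).
have [g2 e2] := hJ _ _ _ hi (p2 \oc f).
exists (i1 \oc g1 + i2 \oc g2).
by rewrite comp_addl -!comp_assoc e1 e2 !comp_assoc -comp_addl e comp_idl.
Qed.

Definition null_maps X Y : {pred Hom X Y} := fun f => `[< factors_inj f >].

Lemma null_mapsP X Y (f : Hom X Y) :
  reflect (factors_inj f) (f \in @null_maps X Y).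
Proof. exact: asboolP. Qed.

Lemma null_maps_closed X Y : zmod_closed (@null_maps X Y).
Proof.
have [[Z hZ] biprod] := ex_additive (fr_exact E).
split=> [|f g /null_mapsP[I [a [b [hI ->]]]] /null_mapsP[J [c [d [hJ ->]]]]].
  apply/null_mapsP; exists Z, 0, 0; split; last by rewrite comp0l.
  move=> A B i _ f; exists 0.
  by rewrite comp0l -[f]comp_idl hZ comp0l.
have [S hS] := biprod I J; apply/null_mapsP.
have hSi := biproduct_injective hS hI hJ.
have [i1 [i2 [p1 [p2 [e11 e22 e21 e12 _]]]]] := hS.
exists S, (i1 \oc a - i2 \oc c), (b \oc p1 + d \oc p2); split=> //.
rewrite comp_addl !compBr -!comp_assoc !(comp_assoc p1) !(comp_assoc p2).
by rewrite e11 e22 e21 e12 !comp0l !comp_idl comp0r subr0 comp0r sub0r.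
Qed.

HB.instance Definition _ X Y :=
  GRing.isZmodClosed.Build (Hom X Y) (@null_maps X Y) (@null_maps_closed X Y).

Definition stHom X Y : zmodType := Quotient.quot (@null_maps X Y).

Definition stpi X Y (f : Hom X Y) : stHom X Y :=
  \pi_(Quotient.quot (@null_maps X Y)) f.

Definition strep X Y (f : stHom X Y) : Hom X Y := repr f.

Lemma strepK X Y (f : stHom X Y) : stpi (strep f) = f.
Proof. exact: reprK. Qed.

Lemma stpi_eq X Y (f g : Hom X Y) : stpi f = stpi g <-> factors_inj (f - g).
Proof.
rewrite /stpi; split=> [/eqP|h].
  by rewrite -Quotient.idealrBE => /null_mapsP.
by apply/eqP; rewrite -Quotient.idealrBE; apply/null_mapsP.
Qed.

Lemma stpiD X Y (f g : Hom X Y) : stpi (f + g) = stpi f + stpi g.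
Proof. exact: (raddfD (\pi_(Quotient.quot (@null_maps X Y)))). Qed.

Lemma stpiB X Y (f g : Hom X Y) : stpi (f - g) = stpi f - stpi g.
Proof. exact: (raddfB (\pi_(Quotient.quot (@null_maps X Y)))). Qed.

Definition stcomp X Y Z (g : stHom Y Z) (f : stHom X Y) : stHom X Z :=
  stpi (strep g \oc strep f).

Lemma stcompE X Y Z (g : Hom Y Z) (f : Hom X Y) :
  stcomp (stpi g) (stpi f) = stpi (g \oc f).
Proof.
have /stpi_eq[I [a [b [hI eg]]]] := strepK (stpi g).
have /stpi_eq[J [c [d [hJ ef]]]] := strepK (stpi f).
rewrite /stcomp; set g' := strep _ in eg *; set f' := strep _ in ef *.
transitivity (stpi (g \oc f')); apply/stpi_eq.
  by exists I, (a \oc f'), b; split=> //; rewrite -compBl eg comp_assoc.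
by exists J, c, (g \oc d); split=> //; rewrite -compBr ef comp_assoc.
Qed.

Program Definition stable_cat : preadditive :=
  @Preadditive E stHom (fun X => stpi (idm X)) stcomp _ _ _ _ _.
Next Obligation. by move=> X Y f; rewrite -[f]strepK stcompE comp_idl. Qed.
Next Obligation. by move=> X Y f; rewrite -[f]strepK stcompE comp_idr. Qed.
Next Obligation.
move=> X Y Z W h g f; rewrite -[h]strepK -[g]strepK -[f]strepK.
by rewrite !stcompE comp_assoc.
Qed.
Next Obligation.
move=> X Y Z g g' f; rewrite -[g]strepK -[g']strepK -[f]strepK.
by rewrite -stpiD !stcompE comp_addl stpiD.
Qed.
Next Obligation.
move=> X Y Z g f f'; rewrite -[g]strepK -[f]strepK -[f']strepK.
by rewrite -stpiD !stcompE comp_addr stpiD.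
Qed.

(* ih_coz is the suspension of X in the stable category. *)
Record inj_hull X := InjHull {
  ih_ob : E;
  ih_coz : E;
  ih_inc : Hom X ih_ob;
  ih_pr : Hom ih_ob ih_coz;
  ih_confl : confl ih_inc ih_pr;
  ih_inj : injective_object (@confl E) ih_ob
}.

Lemma inj_hull_exists X : exists h : inj_hull X, True.
Proof.
have [I [i [[Z [p hip]] hI]]] := fr_enough_inj X.
by exists (InjHull hip hI).
Qed.

Definition hull X : inj_hull X := projT1 (cid (inj_hull_exists X)).

Local Notation inc X := (ih_inc (hull X)).
Local Notation pr X := (ih_pr (hull X)).

Definition stsusp_ob (X : stable_cat) : stable_cat := ih_coz (hull X).

Definition susp_lift X Y (f : Hom X Y) (h : @Hom E (stsusp_ob X) (stsusp_ob Y)) : Prop :=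
  exists g : Hom (ih_ob (hull X)) (ih_ob (hull Y)),
    g \oc inc X = inc Y \oc f /\ h \oc pr X = pr Y \oc g.

Lemma hull_cok X : is_cokernel (inc X) (pr X).
Proof. exact: (ex_kercoker (fr_exact E) (ih_confl _)).2. Qed.

Lemma hull_mono X : adm_mono (@confl E) (inc X).
Proof. by exists (ih_coz (hull X)), (pr X); apply: ih_confl. Qed.

Lemma susp_lift_exists X Y (f : Hom X Y) : exists h, susp_lift f h.
Proof.
have [g eg] := ih_inj (hull_mono X) (inc Y \oc f).
have h0 : (pr Y \oc g) \oc inc X = 0.
  by rewrite -comp_assoc eg comp_assoc (hull_cok Y).1 comp0l.
have [h [eh _]] := (hull_cok X).2 _ _ h0.
by exists h, g.
Qed.

Lemma susp_lift_null X Y (f : Hom X Y) h :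
  susp_lift f h -> factors_inj f -> factors_inj h.
Proof.
move=> [g [eg eh]] [J [a [b [hJ ef]]]].
have [a' ea] := hJ _ _ _ (hull_mono X) a.
have h0 : (g - inc Y \oc b \oc a') \oc inc X = 0.
  by rewrite compBl eg ef -!comp_assoc ea subrr.
have [c [ec _]] := (hull_cok X).2 _ _ h0.
exists (ih_ob (hull Y)), c, (pr Y); split; first exact: ih_inj.
apply: (cokernel_epi (hull_cok X)).
rewrite eh -comp_assoc ec compBr !comp_assoc (hull_cok Y).1.
by rewrite !comp0l subr0.
Qed.

Lemma susp_liftB X Y (f f' : Hom X Y) h h' :
  susp_lift f h -> susp_lift f' h' -> susp_lift (f - f') (h - h').
Proof.
move=> [g [e1 e2]] [g' [e1' e2']]; exists (g - g').
by rewrite !compBl !compBr e1 e2 e1' e2'.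
Qed.

Definition stsusp_map X Y (f : stHom X Y) : stHom (stsusp_ob X) (stsusp_ob Y) :=
  stpi (projT1 (cid (susp_lift_exists (strep f)))).

Lemma stsusp_mapE X Y (f : Hom X Y) h :
  susp_lift f h -> stsusp_map (stpi f) = stpi h.
Proof.
move=> hfh; rewrite /stsusp_map; case: cid => h' /= hfh'.
apply/stpi_eq; apply: susp_lift_null (susp_liftB hfh' hfh) _.
by apply/stpi_eq; rewrite strepK.
Qed.

Lemma stsusp_map_is_additive X Y : zmod_morphism (@stsusp_map X Y).
Proof.
move=> f g; rewrite -[f]strepK -[g]strepK.
have [h1 e1] := susp_lift_exists (strep f).
have [h2 e2] := susp_lift_exists (strep g).
rewrite -stpiB (stsusp_mapE (susp_liftB e1 e2)).
by rewrite (stsusp_mapE e1) (stsusp_mapE e2) stpiB.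
Qed.

HB.instance Definition _ X Y := GRing.isZmodMorphism.Build (stHom X Y)
  (stHom (stsusp_ob X) (stsusp_ob Y)) (@stsusp_map X Y)
  (@stsusp_map_is_additive X Y).

Program Definition stable_susp : functor stable_cat stable_cat :=
  @Functor stable_cat stable_cat stsusp_ob (fun X Y => @stsusp_map X Y) _ _.
Next Obligation.
move=> X; apply: stsusp_mapE; exists (idm _).
by rewrite !comp_idl !comp_idr.
Qed.
Next Obligation.
move=> X Y Z g f /=; rewrite -[g]strepK -[f]strepK.
have [h1 e1] := susp_lift_exists (strep f).
have [h2 e2] := susp_lift_exists (strep g).
rewrite (stsusp_mapE e1) (stsusp_mapE e2) !stcompE; apply: stsusp_mapE.
case: e1 e2 => [a [a1 a2]] [b [b1 b2]]; exists (b \oc a).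
by rewrite -!comp_assoc a1 a2 !comp_assoc b1 b2.
Qed.

(* The standard triangle X -> Y -> Z -> Sigma X of a conflation (i, p):
   w is induced by any extension e : Y -> I(X) of X -> I(X) along i. *)
Definition standard_triangle X Y Z (i : Hom X Y) (p : Hom Y Z)
    (w : @Hom E Z (stsusp_ob X)) : Prop :=
  confl i p /\
  exists e : Hom Y (ih_ob (hull X)), e \oc i = inc X /\ w \oc p = pr X \oc e.

Definition stable_dist (X Y Z : stable_cat) (f : Hom X Y) (g : Hom Y Z)
    (h : Hom Z (stable_susp X)) : Prop :=
  exists (X' Y' Z' : E) (i : Hom X' Y') (p : Hom Y' Z')
    (w : @Hom E Z' (stsusp_ob X'))
    (a : @Hom stable_cat X' X) (b : @Hom stable_cat Y' Y)
    (c : @Hom stable_cat Z' Z),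
    [/\ standard_triangle i p w,
        [/\ is_iso a, is_iso b & is_iso c],
        b \oc stpi i = f \oc a,
        c \oc stpi p = g \oc b &
        fmap stable_susp a \oc stpi w = h \oc c].

Definition stable_tri : tri_data stable_cat := TriData stable_dist.

End Stable.

(* No k-linearity is required of E or of the equivalence. *)
Definition algebraic (C : preadditive) (T : tri_data C) : Prop :=
  exists (E : frobenius) (F : functor C (stable_cat E)),
    triangle_equivalence T (stable_tri E) F.

Record linear_cat (k : fieldType) := LinearCat {
  lOb :> Type;
  lHom : lOb -> lOb -> lmodType k;
  lidm : forall X, lHom X X;
  lcomp : forall X Y Z, lHom Y Z -> lHom X Y -> lHom X Z;
  lcomp_idl : forall X Y (f : lHom X Y), lcomp (lidm Y) f = f;
  lcomp_idr : forall X Y (f : lHom X Y), lcomp f (lidm X) = f;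
  lcomp_assoc : forall X Y Z W (h : lHom Z W) (g : lHom Y Z) (f : lHom X Y),
    lcomp h (lcomp g f) = lcomp (lcomp h g) f;
  lcomp_addl : forall X Y Z (g g' : lHom Y Z) (f : lHom X Y),
    lcomp (g + g') f = lcomp g f + lcomp g' f;
  lcomp_addr : forall X Y Z (g : lHom Y Z) (f f' : lHom X Y),
    lcomp g (f + f') = lcomp g f + lcomp g f';
  lcomp_scalel : forall X Y Z a (g : lHom Y Z) (f : lHom X Y),
    lcomp (a *: g) f = a *: lcomp g f;
  lcomp_scaler : forall X Y Z a (g : lHom Y Z) (f : lHom X Y),
    lcomp g (a *: f) = a *: lcomp g f
}.

Definition preadditive_of (k : fieldType) (C : linear_cat k) : preadditive :=
  @Preadditive C (fun X Y => lHom X Y) (@lidm k C) (@lcomp k C)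
    (@lcomp_idl k C) (@lcomp_idr k C) (@lcomp_assoc k C)
    (@lcomp_addl k C) (@lcomp_addr k C).

Record linear_triangulated (k : fieldType) := LinearTriangulated {
  lt_cat :> linear_cat k;
  lt_tri : triangulated (preadditive_of lt_cat);
  lt_susp_scale : forall (X Y : preadditive_of lt_cat) (a : k) (f : lHom X Y),
    fmap (susp lt_tri) (a *: f : lHom X Y) =
    a *: (fmap (susp lt_tri) f : lHom (susp lt_tri X) (susp lt_tri Y))
}.

Definition has_dim (k : fieldType) (V : lmodType k) (d : nat) : Prop :=
  exists f : {linear 'rV[k]_d -> V}, bijective f.

Definition spherical (k : fieldType) (C : linear_triangulated k) (m : nat)
    (s : C) : Prop :=
  forall l : int,
    has_dim (@lHom k C s (susp_pow (lt_tri C) l s))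
      (if (l == 0) || (l == m%:Z) then 1 else 0).

(* These properties determine C up to triangle equivalence. *)
Definition is_cluster_cat_Ainf (k : fieldType) (n : nat)
    (C : linear_triangulated k) : Prop :=
  [/\ algebraic (lt_tri C),
      idempotent_complete (preadditive_of C) &
      exists s : C, spherical n.+1 s /\ classically_generated (lt_tri C) s].

(* Main.v *)
From HB Require Import structures.
From mathcomp Require Import all_boot all_algebra.
From mathcomp Require Import boolp zify.
From mathcomp.multinomials Require Import freeg.
Require Import Defs.

Set Implicit Arguments.
Unset Strict Implicit.
Unset Printing Implicit Defensive.

Import GRing.Theory Num.Theory.
Local Open Scope ring_scope.
Local Open Scope cat_scope.

(** A suitable cohomology has an Euler characteristic, which shows that the class of
    the spherical object s has infinite order, and a total dimension, on which an
    induction shows that this class generates K0. Write S for the suspension.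

    The category behaves like the derived category of finite-dimensional dg
    modules over k[t], with t of degree -n and s the simple module k. There one
    reads off K0 from the total cohomology of a module, which is represented by
    the free module k[t]. That module is not an object of the category, but it is
    approximated by the truncations k[t]/(t^(i+1)), and these can be built from s
    by cones alone: the tower E_0 = s, E_1, E_2, ... is defined by triangles
      E_i -> S^((n+1)(i+1)) s -> E_(i+1) -> S E_i
    with a nonzero first map, and E_i plays the part of S^i (k[t]/(t^(i+1))).
    By induction, Hom(E_i, S^q s) is a line for q = i and for q = (n+1)(i+1), and
    zero otherwise ([tower_exists]). The degree q = i carries the cohomology of s;
    the degree (n+1)(i+1) is an error of the truncation, which moves away from i
    as i grows.

    Call X bounded if, for some L and all q >= L, the dimension of Hom(E_i, S^q X) is
    at most a constant, and zero when q <= 2i - L lies at distance at least L from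
    i. Such objects form a thick subcategory that contains s, hence are all objects
    ([bounded_tower]). So for large m the dimensions of
    Hom(E_2m, S^q X) with m <= q < 3m record the cohomology of X only. Their
    alternating sum is additive on triangles as soon as m is large, because the
    long exact sequence can be cut at the ends of the window, where it vanishes
    ([window_sum_dist]); its value on s is 1. Therefore the class of s has
    infinite order ([K0_class_infinite_order]).

    The class of s also generates K0. Generation by s alone only gives every
    object as a direct summand of an iterated extension of shifts of s, and a
    summand could have a class outside the subgroup spanned by [s]. Instead, every
    nonzero X is shrunk directly: choose a nonzero map f : S^p s -> S^q X with
    q - p as small as possible ([exists_low_map]). In the model, X has no
    cohomology below that degree, t kills the lowest cohomology, and so f is
    injective on cohomology. Abstractly, composing f with the projection from the
    tower to s stays nonzero ([tower_gen]). Hence the cone of f has a total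
    cohomology smaller by one ([cone_drop]), and induction on this dimension shows
    that [X] is a multiple of [s] ([K0_class_generated]). *)

(** * Dimensions of subspaces and ranks *)

Section Dimension.
Variable k : fieldType.
Implicit Types V W A B C : lmodType k.

(** Subspaces are predicates rather than types, so that kernels and images of
    maps between Hom spaces need no module structure of their own. *)
Definition is_dim V (U : V -> Prop) (d : nat) : Prop :=
  exists phi : {linear 'rV[k]_d -> V},
    injective phi /\ forall v, U v <-> exists x, v = phi x.

Lemma is_dim_le V (U U' : V -> Prop) d d' : is_dim U d -> is_dim U' d' ->
  (forall v, U v -> U' v) -> (d <= d')%N.
Proof.
move=> [phi [phi_inj phiU]] [psi [psi_inj psiU']] sub.
have lift (i : 'I_d) : exists x, phi (delta_mx 0 i) = psi x.
  by apply/psiU'/sub/phiU; exists (delta_mx 0 i).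
have [g hg] := choice lift.
pose M : 'M_(d, d') := \matrix_i g i.
have phiE x : phi x = psi (x *m M).
  rewrite {1}[x]row_sum_delta mulmx_sum_row !linear_sum.
  by apply: eq_bigr => i _; rewrite !linearZ /= hg rowK.
suff /eqP <- : row_free M by exact: rank_leq_col.
rewrite -kermx_eq0; apply/eqP/row_matrixP => i; apply: phi_inj.
by rewrite phiE -row_mul mulmx_ker !row0 !linear0.
Qed.

Lemma is_dim_uniq V (U : V -> Prop) d d' : is_dim U d -> is_dim U d' -> d = d'.
Proof.
move=> h h'; apply/eqP; rewrite eqn_leq.
by rewrite (is_dim_le h h') // (is_dim_le h' h).
Qed.

Lemma is_dim_ext V (U U' : V -> Prop) d :
  (forall v, U v <-> U' v) -> is_dim U d -> is_dim U' d.
Proof.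
move=> e [phi [inj h]]; exists phi; split=> // v.
by split=> [/e/h|/h/e].
Qed.

(** The rows of a matrix of largest rank with rows in U already span U: a vector
    of U outside their span could be added as a further row. *)
Lemma subspace_row_free m (U : 'rV[k]_m -> Prop) :
  U 0 -> (forall a x y, U x -> U y -> U (a *: x + y)) ->
  exists r (M : 'M[k]_(r, m)), row_free M /\ forall x, U x <-> (x <= M)%MS.
Proof.
move=> U0 UL.
pose P r := `[< exists M : 'M[k]_(r, m), row_free M /\ forall i, U (row i M) >].
have exP : exists r, P r.
  exists 0%N; apply/asboolP; exists 0; split; last by case.
  by rewrite /row_free mxrank0.
have ubP r : P r -> (r <= m)%N.
  by move=> /asboolP[M [/eqP rM _]]; rewrite -rM rank_leq_col.
case: (ex_maxnP exP ubP) => r /asboolP[M [Mfree MU]] rmax.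
exists r, M; split=> // x; split=> [Ux|/submxP[D ->]]; last first.
  rewrite mulmx_sum_row; elim/big_rec: _ => // i y _ Uy.
  exact: UL.
apply: contraT => xM.
suff : P (1 + r)%N by move=> /rmax; rewrite add1n ltnn.
apply/asboolP; exists (col_mx x M); split; last first.
  by move=> i; case: (split_ordP i) => j ->; rewrite (rowKu, rowKd) ?ord1 ?row_id.
rewrite /row_free eqn_leq rank_leq_row /=.
rewrite -addsmxE add1n -{1}(eqP Mfree) rank_ltmx //.
rewrite ltmxE addsmxSr /=; apply: contra xM.
exact: submx_trans (addsmxSl _ _).
Qed.

(** Rank-nullity, by splitting the coordinate space into the kernel and a
    complement, on which f is injective. *)
Lemma is_dim_ker_im V W (f : {linear V -> W}) d :
  is_dim (fun _ : V => True) d ->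
  exists a b, [/\ is_dim (fun v => f v = 0) a,
    is_dim (fun w => exists v, w = f v) b & d = (a + b)%N].
Proof.
move=> [phi [phi_inj phiT]].
have [||r [M [Mfree kerM]]] := @subspace_row_free d (fun x => f (phi x) = 0).
- by rewrite !linear0.
- by move=> a x y hx hy; rewrite !linearP hx hy scaler0 addr0.
pose N := row_base (M^C)%MS.
have Nfree : row_free N by exact: row_base_free.
exists r, (\rank (M^C)%MS); split; last first.
- by rewrite mxrank_compl (eqP Mfree) subnKC // -(eqP Mfree) rank_leq_col.
- exists (f \o phi \o mulmxr N : {linear _ -> _}); split.
    apply: raddf_inj => x /= /kerM xM.
    have : (x *m N <= M :&: M^C)%MS.
      by rewrite sub_capmx xM (submx_trans (submxMl _ _)) // eq_row_base.
    rewrite capmx_compl submx0 => /eqP xN0.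
    by apply: (row_free_inj Nfree); rewrite xN0 mul0mx.
  move=> w; split=> [[v ->]|[x ->]]; last by exists (phi (x *m N)).
  have [x ->] := (phiT v).1 I.
  have /sub_addsmxP[[y z] xE] : (x <= M + N)%MS.
    apply: submx_full; rewrite /N -sub1mx.
    by rewrite (adds_eqmx (eqmx_refl M) (eq_row_base _)) sub1mx addsmx_compl_full.
  exists z; rewrite xE !linearD /= (_ : f (phi (y *m M)) = 0) ?add0r //.
  by apply/kerM; exact: submxMl.
- exists (phi \o mulmxr M : {linear _ -> _}); split.
    by move=> x y /= /phi_inj /(row_free_inj Mfree).
  move=> v; split=> [|[x ->]]; last by apply/kerM; exact: submxMl.
  have [x ->] := (phiT v).1 I.
  by move=> /kerM /submxP[y ->]; exists y.
Qed.

Lemma is_dim_sub V (U U' : V -> Prop) d : is_dim U d -> (forall v, U' v -> U v) ->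
  U' 0 -> (forall a x y, U' x -> U' y -> U' (a *: x + y)) ->
  exists2 d', is_dim U' d' & (d' <= d)%N.
Proof.
move=> hU sub U0 UL; have [phi [phi_inj phiU]] := hU.
have [||r [M [Mfree UM]]] := @subspace_row_free d (fun x => U' (phi x)).
- by rewrite linear0.
- by move=> a x y hx hy; rewrite linearP; exact: UL.
suff hU' : is_dim U' r by exists r => //; exact: is_dim_le hU' hU sub.
exists (phi \o mulmxr M : {linear _ -> _}); split.
  by move=> x y /= /phi_inj /(row_free_inj Mfree).
move=> v; split=> [Uv|[x ->]]; last by apply/UM; exact: submxMl.
have [x vE] := (phiU v).1 (sub _ Uv).
by move: Uv; rewrite vE => /UM /submxP[y ->]; exists y.
Qed.

(** The converse of [is_dim_ker_im], where the dimension of V is not yet known: a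
    basis of the image is lifted to V and joined to a basis of the kernel. *)
Lemma is_dim_extension V W (f : {linear V -> W}) a b :
  is_dim (fun v => f v = 0) a -> is_dim (fun w => exists v, w = f v) b ->
  is_dim (fun _ : V => True) (a + b).
Proof.
move=> [ker [ker_inj kerE]] [im [im_inj imE]].
have lift (i : 'I_b) : exists v, im (delta_mx 0 i) = f v.
  by apply/imE; exists (delta_mx 0 i).
have [g hg] := choice lift.
pose psi (x : 'rV[k]_b) : V := \sum_i x 0 i *: g i.
have psi_lin : linear psi.
  move=> c x y; rewrite /psi scaler_sumr -big_split; apply: eq_bigr => i _ /=.
  by rewrite !mxE scalerDl scalerA.
pose Psi : {linear _ -> _} := HB.pack psi (GRing.isLinear.Build _ _ _ _ psi psi_lin).
have fpsi x : f (psi x) = im x.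
  rewrite [in RHS](row_sum_delta x) !linear_sum.
  by apply: eq_bigr => i _; rewrite !linearZ /= hg.
exists ((ker \o lsubmx) \+ (Psi \o rsubmx) : {linear _ -> _}); split.
  apply: raddf_inj => x /= x0.
  have xr : rsubmx x = 0.
    apply: im_inj; rewrite linear0 -fpsi -[RHS](linear0 f) -x0 linearD.
    by rewrite (_ : f (ker _) = 0) ?add0r //; apply/kerE; exists (lsubmx x).
  have xl : lsubmx x = 0.
    apply: ker_inj; rewrite linear0 -x0 xr.
    by rewrite (linear0 Psi : psi 0 = 0) addr0.
  by rewrite -[x]hsubmxK xl xr row_mx0.
move=> v; split=> // _.
have [y fvE] : exists y, f v = im y by apply/imE; exists v.
have [x vE] : exists x, v - psi y = ker x.
  by apply/kerE; rewrite linearB fvE fpsi subrr.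
by exists (row_mx x y); rewrite /= row_mxKl row_mxKr -vE subrK.
Qed.

(** The default value 0 makes dimensions and ranks total functions, which can be
    summed without carrying proofs of finiteness. *)
Definition dim_of V (U : V -> Prop) : nat :=
  if pselect (exists d, is_dim U d) is left h then projT1 (cid h) else 0%N.

Definition dim V : nat := dim_of (fun _ : V => True).

Definition rank V W (f : V -> W) : nat := dim_of (fun w => exists v, w = f v).

Definition dim_le V (b : nat) : Prop :=
  exists2 d, is_dim (fun _ : V => True) d & (d <= b)%N.

Definition exact A B C (f : A -> B) (g : B -> C) : Prop :=
  forall b : B, g b = 0 <-> exists a, b = f a.

Lemma dim_ofE V (U : V -> Prop) d : is_dim U d -> dim_of U = d.
Proof.
rewrite /dim_of => hd; case: pselect => [h|[]]; last by exists d.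
by case: cid => d' /= hd'; exact: is_dim_uniq hd' hd.
Qed.

Lemma dim_ofP V (U : V -> Prop) d : is_dim U d -> is_dim U (dim_of U).
Proof. by move=> h; rewrite (dim_ofE h). Qed.

Lemma dim_leP V b : dim_le V b -> is_dim (fun _ : V => True) (dim V).
Proof. by case=> d /dim_ofP. Qed.

Lemma dim_le_dim V b : dim_le V b -> (dim V <= b)%N.
Proof. by case=> d /dim_ofE; rewrite /dim => ->. Qed.

Lemma dim_leW V b c : (b <= c)%N -> dim_le V b -> dim_le V c.
Proof. by move=> bc [d hd db]; exists d => //; exact: leq_trans bc. Qed.

Lemma is_dim0 V (U : V -> Prop) : (forall v, U v <-> v = 0) -> is_dim U 0.
Proof.
move=> U0; exists \0; split; first by move=> x y _; rewrite !thinmx0.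
by move=> v; rewrite U0; split=> [->|[x ->]] //; exists 0.
Qed.

Lemma dim_le0 V : dim_le V 0 <-> forall v : V, v = 0.
Proof.
split=> [[d [phi [_ phiT]]]|V0].
  rewrite leqn0 => /eqP d0 v; subst d; have [x ->] := (phiT v).1 I.
  by rewrite thinmx0 linear0.
by exists 0%N => //; apply: is_dim0 => v; split.
Qed.

Lemma is_dim1 V (v0 : V) : v0 != 0 -> (forall v, exists c, v = c *: v0) ->
  is_dim (fun _ : V => True) 1.
Proof.
move=> v0nz v0gen; pose phi (x : 'rV[k]_1) := x 0 0 *: v0.
have phi_lin : linear phi.
  by move=> a x y; rewrite /phi !mxE scalerDl scalerA.
pose Phi : {linear _ -> _} := HB.pack phi (GRing.isLinear.Build _ _ _ _ phi phi_lin).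
exists Phi; split.
  move=> x y /eqP; rewrite /= -subr_eq0 -scalerBl scaler_eq0 (negPf v0nz) orbF.
  by rewrite subr_eq0 => /eqP e; apply/matrixP=> i j; rewrite !ord1.
move=> v; split=> // _; have [c ->] := v0gen v.
by exists (c%:M); rewrite /= /phi mxE eqxx mulr1n.
Qed.

Lemma is_dim_im V W (f : {linear V -> W}) b : dim_le V b ->
  is_dim (fun w => exists v, w = f v) (rank f) /\ (rank f <= b)%N.
Proof.
move=> [d hd db]; have [r1 [r2 [_ h2 dE]]] := is_dim_ker_im f hd.
by rewrite (dim_ofE h2 : rank f = r2); split=> //; apply: leq_trans db; rewrite dE leq_addl.
Qed.

Lemma is_dim_im_codomain V W (f : {linear V -> W}) b : dim_le W b ->
  is_dim (fun w => exists v, w = f v) (rank f) /\ (rank f <= b)%N.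
Proof.
move=> [d hd db].
have [//|||r hr rd] := is_dim_sub (U' := fun w => exists v, w = f v) hd.
- by exists 0; rewrite linear0.
- by move=> a _ _ [x ->] [y ->]; exists (a *: x + y); rewrite linearP.
by rewrite (dim_ofE hr : rank f = r); split=> //; apply: leq_trans db.
Qed.

(** This bound is what makes finiteness and vanishing of Hom spaces pass to cones. *)
Lemma dim_le_exact A B C (f : {linear A -> B}) (g : {linear B -> C}) a c :
  exact f g -> dim_le A a -> dim_le C c -> dim_le B (a + c).
Proof.
move=> fg hA hC; have [hf fa] := is_dim_im f hA.
have [hg gc] := is_dim_im_codomain g hC.
exists (rank f + rank g)%N; last by rewrite leq_add.
by apply: is_dim_extension hg; apply: is_dim_ext hf => v; rewrite fg.
Qed.

(** In a long exact sequence each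
    rank is shared by two consecutive terms, which makes alternating sums telescope. *)
Lemma dim_exact A B C (f : {linear A -> B}) (g : {linear B -> C}) b :
  exact f g -> dim_le B b -> dim B = (rank f + rank g)%N.
Proof.
move=> fg /dim_leP hB; have [r1 [r2 [h1 h2 ->]]] := is_dim_ker_im g hB.
rewrite (dim_ofE h2 : rank g = r2); congr addn; apply/esym/dim_ofE.
by apply: is_dim_ext h1 => v; rewrite fg.
Qed.

Lemma dim_le_inj V W (f : {linear V -> W}) b :
  (forall v, f v = 0 -> v = 0) -> dim_le W b -> dim_le V b.
Proof.
move=> f_inj /(is_dim_im_codomain f)[hf fb]; exists (rank f) => //.
rewrite -[rank f]add0n; apply: is_dim_extension hf; apply: is_dim0 => v.
by split=> [/f_inj //|->]; rewrite linear0.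
Qed.

Lemma rank_inj V W (f : {linear V -> W}) b :
  (forall v, f v = 0 -> v = 0) -> dim_le V b -> rank f = dim V.
Proof.
move=> f_inj /dim_leP hV; have [r1 [r2 [h1 h2 ->]]] := is_dim_ker_im f hV.
rewrite (dim_ofE h2 : rank f = r2) (is_dim_uniq h1 (is_dim0 _)) // => v.
by split=> [/f_inj //|->]; rewrite linear0.
Qed.

Lemma rank_surj V W (f : {linear V -> W}) b :
  (forall w, exists v, w = f v) -> dim_le W b -> rank f = dim W.
Proof.
move=> f_surj /dim_leP hW; apply: dim_ofE.
by apply: is_dim_ext hW => w; split.
Qed.

Lemma rank0 V W (f : {linear V -> W}) : (forall v, f v = 0) -> rank f = 0%N.
Proof.
move=> f0; apply/dim_ofE/is_dim0 => w.
by split=> [[v ->] //|->]; exists 0; rewrite linear0.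
Qed.

Lemma dim_eq0 V : dim_le V 0 -> dim V = 0%N.
Proof. by move=> /dim_le_dim; rewrite leqn0 => /eqP. Qed.

Lemma rank_eq0_l V W (f : {linear V -> W}) : dim_le V 0 -> rank f = 0%N.
Proof. by move=> /dim_le0 V0; apply: rank0 => v; rewrite [v]V0 linear0. Qed.

End Dimension.

(** * Retracts and vanishing Hom groups *)

Section Preadditive.
Variable C : preadditive.
Implicit Types X Y Z A B S : C.

Definition hom0 X Y : Prop := forall f : Hom X Y, f = 0.

Definition retract X S : Prop :=
  exists (i : Hom X S) (r : Hom S X), r \oc i = idm X.

Lemma is_zero_homr X Z : is_zero Z -> hom0 X Z.
Proof. by move=> Z0 f; rewrite -[f]comp_idl Z0 comp0l. Qed.

Lemma is_zero_homl X Z : is_zero Z -> hom0 Z X.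
Proof. by move=> Z0 f; rewrite -[f]comp_idr Z0 comp0r. Qed.

Lemma retract_iso X Y : isomorphic X Y -> retract Y X.
Proof. by move=> [f [g [gf fg]]]; exists g, f. Qed.

Lemma retract_summand X Y S : biproduct X Y S -> retract X S.
Proof. by move=> [i1 [i2 [p1 [p2 [e _ _ _ _]]]]]; exists i1, p1. Qed.

Lemma hom0_retractl X X' Y : retract X' X -> hom0 X Y -> hom0 X' Y.
Proof.
move=> [i [r ri]] h f; rewrite -[f]comp_idr -ri comp_assoc (h (f \oc r)).
exact: comp0l.
Qed.

Lemma hom0_retractr X Y Y' : retract Y' Y -> hom0 X Y -> hom0 X Y'.
Proof.
move=> [i [r ri]] h f; rewrite -[f]comp_idl -ri -comp_assoc (h (i \oc f)).
exact: comp0r.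
Qed.

Lemma isomorphic_sym X Y : isomorphic X Y -> isomorphic Y X.
Proof. by move=> [f [g [gf fg]]]; exists g, f. Qed.

End Preadditive.

(** * Quotients by generated subgroups and eventual properties *)

Section Quotient.
Variables (V : zmodType) (P : V -> Prop).

Lemma quotient_pi_eq (x y : V) :
  quotient_pi P x = quotient_pi P y <-> x - y \in gen_subgroup P.
Proof.
rewrite /quotient_pi; split=> [/eqP|h]; first by rewrite -Quotient.idealrBE.
by apply/eqP; rewrite -Quotient.idealrBE.
Qed.

Lemma mem_gen_subgroup (x : V) :
  P x -> x \in gen_subgroup P.
Proof. by move=> Px; apply/gen_subgroupP => H _ _; exact. Qed.

Lemma quotient_piB (x y : V) :
  quotient_pi P (x - y) = quotient_pi P x - quotient_pi P y.
Proof. exact: (raddfB (\pi_(Quotient.quot (gen_subgroup P)))%qT). Qed.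

Lemma quotient_piD (x y : V) :
  quotient_pi P (x + y) = quotient_pi P x + quotient_pi P y.
Proof. exact: (raddfD (\pi_(Quotient.quot (gen_subgroup P)))%qT). Qed.

Lemma quotient_pi0 : quotient_pi P 0 = 0.
Proof. exact: (raddf0 (\pi_(Quotient.quot (gen_subgroup P)))%qT). Qed.

Lemma quotient_piMz (x : V) c :
  quotient_pi P (x *~ c) = quotient_pi P x *~ c.
Proof. exact: (raddfMz (\pi_(Quotient.quot (gen_subgroup P)))%qT). Qed.

Lemma quotient_pi_eq0 (x : V) :
  P x -> quotient_pi P x = 0.
Proof.
move=> Px; rewrite -[RHS]quotient_pi0; apply/quotient_pi_eq.
by rewrite subr0; exact: mem_gen_subgroup.
Qed.

Lemma quotient_pi_surj (x : quotient_by P) :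
  exists y, x = quotient_pi P y.
Proof. by exists (repr x); rewrite /quotient_pi reprK. Qed.

End Quotient.

Section Eventually.

Definition eventually (P : nat -> Prop) : Prop :=
  exists M, forall m, (M <= m)%N -> P m.

Lemma eventually_and (P Q : nat -> Prop) :
  eventually P -> eventually Q -> eventually (fun m => P m /\ Q m).
Proof.
move=> [M hM] [N hN]; exists (maxn M N) => m; rewrite geq_max => /andP[Mm Nm].
by split; [exact: hM | exact: hN].
Qed.

Lemma eventually_mono (P Q : nat -> Prop) :
  (forall m, P m -> Q m) -> eventually P -> eventually Q.
Proof. by move=> PQ [M hM]; exists M => m /hM /PQ. Qed.

End Eventually.

(** * Long exact sequences *)

Section Triangulated.
Variables (C : preadditive) (T : triangulated C).
Implicit Types X Y Z A B S : C.

Local Notation Sg := (susp T).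
Local Notation D := (desusp T).

Lemma susp_desusp_iso X : isomorphic (Sg (D X)) X.
Proof. exists (ncomp (qinv_counit D) X); exact: (ncomp_iso (qinv_counit D) X). Qed.

Lemma susp_faithful X Y (f : Hom X Y) : fmap Sg f = 0 -> f = 0.
Proof.
move=> f0; have nat := ncomp_nat (qinv_unit D) f.
have [u [uV _]] := ncomp_iso (qinv_unit D) X.
move: nat; rewrite /= f0 raddf0 comp0r => /esym e.
rewrite -[f]comp_idr; have [v [_ <-]] := ncomp_iso (qinv_unit D) X.
by rewrite comp_assoc e comp0l.
Qed.

Lemma desusp_faithful X Y (f : Hom X Y) : fmap D f = 0 -> f = 0.
Proof.
move=> f0; have nat := ncomp_nat (qinv_counit D) f.
move: nat; rewrite /= f0 raddf0 comp0r => /esym e.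
rewrite -[f]comp_idr; have [v [_ <-]] := ncomp_iso (qinv_counit D) X.
by rewrite comp_assoc e comp0l.
Qed.

(** A preimage is obtained by conjugating the desuspension of g with the unit; that
    its suspension is g can be tested after desuspending, which is faithful. *)
Lemma susp_full X Y (g : Hom (Sg X) (Sg Y)) : exists f : Hom X Y, fmap Sg f = g.
Proof.
have [u [uV Vu]] := ncomp_iso (qinv_unit D) X.
pose eta := qinv_unit D.
exists (eta Y \oc fmap D g \oc u).
set f := eta Y \oc fmap D g \oc u.
suff : fmap D (fmap Sg f) = fmap D g.
  move=> e; have : fmap D (fmap Sg f - g) = 0 by rewrite raddfB e subrr.
  by move=> /desusp_faithful /eqP; rewrite subr_eq0 => /eqP.
have nat := ncomp_nat eta f.
have [w [wV _]] := ncomp_iso eta Y.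
rewrite -[LHS]comp_idl -wV -comp_assoc [X in w \oc X]nat.
by rewrite /= /f -!comp_assoc uV comp_idr comp_assoc wV comp_idl.
Qed.

Lemma hom0_susp X Y : hom0 (Sg X) (Sg Y) <-> hom0 X Y.
Proof.
split=> h f; first by apply: susp_faithful; exact: h.
by have [g <-] := susp_full f; rewrite (h g) raddf0.
Qed.

Lemma susp_zero Z : is_zero Z -> is_zero (Sg Z).
Proof. by rewrite /is_zero -fmap_id => ->; rewrite raddf0. Qed.

Lemma retract_susp X S : retract X S -> retract (Sg X) (Sg S).
Proof.
by move=> [i [r ri]]; exists (fmap Sg i), (fmap Sg r); rewrite -fmap_comp ri fmap_id.
Qed.

Lemma biproduct_susp X Y S : biproduct X Y S -> biproduct (Sg X) (Sg Y) (Sg S).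
Proof.
move=> [i1 [i2 [p1 [p2 [e1 e2 e3 e4 e5]]]]].
exists (fmap Sg i1), (fmap Sg i2), (fmap Sg p1), (fmap Sg p2).
by rewrite -!fmap_comp -raddfD e1 e2 e3 e4 e5 !fmap_id !raddf0.
Qed.

Local Notation "'S^' q" := (iter q Sg) (at level 9, q at level 9).

Lemma iter_susp_zero q Z : is_zero Z -> is_zero (S^q Z).
Proof. by move=> Z0; elim: q => //= q IHq; exact: susp_zero. Qed.

Lemma retract_iter q X S : retract X S -> retract (S^q X) (S^q S).
Proof. by move=> h; elim: q => //= q IHq; exact: retract_susp. Qed.

Lemma biproduct_iter q X Y S : biproduct X Y S -> biproduct (S^q X) (S^q Y) (S^q S).
Proof. by move=> h; elim: q => //= q IHq; exact: biproduct_susp. Qed.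

(** The q-th suspension of a map up to the sign (-1)^q, which is the sign produced by
    rotating a triangle 3q times. With this choice the same family of maps
    supplies all terms of the long exact sequence: [spow q.+1 f] is the map that
    follows [hpow q h]. *)
Fixpoint spow q X Y (f : Hom X Y) : Hom (S^q X) (S^q Y) :=
  if q is q'.+1 then - fmap Sg (spow q' f) else f.

Fixpoint hpow q X Z (h : Hom Z (Sg X)) : Hom (S^q Z) (S^q.+1 X) :=
  if q is q'.+1 then - fmap Sg (hpow q' h) else h.

Lemma spow_eq0 q X Y (f : Hom X Y) : spow q f = 0 -> f = 0.
Proof.
elim: q => //= q IHq /eqP; rewrite oppr_eq0 => /eqP /susp_faithful.
exact: IHq.
Qed.

Section Triangle.
Variables (X Y Z : C) (f : Hom X Y) (g : Hom Y Z) (h : Hom Z (Sg X)).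
Hypothesis fgh : dist T f g h.

Lemma dist_comp0 : g \oc f = 0.
Proof.
have [O O0] := (tr_additive T).1.
have idX := tr1_id T X O0.
have [|c [<- _]] := tr3 (a := idm X) (b := f) idX fgh; last exact: comp0r.
by [].
Qed.

Lemma dist_spow q : dist T (spow q f) (spow q g) (hpow q h).
Proof.
elim: q => //= q IHq.
by do 3 apply (tr2 _ _ _).1.
Qed.

Lemma dist_rot : dist T g h (- fmap Sg f).
Proof. exact: (tr2 _ _ _).1. Qed.

(** Lift u along f by completing it to a morphism of triangles from A -> 0 -> S A; the
    third map is the suspension of the lift, since S is fully faithful. *)
Lemma dist_cov A (u : Hom A Y) : g \oc u = 0 <-> exists v, u = f \oc v.
Proof.
split=> [gu0|[v ->]]; last by rewrite comp_assoc dist_comp0 comp0l.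
have [O O0] := (tr_additive T).1.
have rotA := (tr2 _ _ _).1 (tr1_id T A O0).
have rotX := (tr2 _ _ _).1 fgh.
have [|c [_]] := tr3 (a := u) (b := 0) rotA rotX; first by rewrite gu0 comp0l.
rewrite fmap_id compNr comp_idr compNl => /oppr_inj.
have [v <-] := susp_full c; rewrite -fmap_comp => e; exists v.
apply/eqP; rewrite -subr_eq0; apply/eqP/susp_faithful.
by rewrite raddfB e subrr.
Qed.

(** Dual to [dist_cov]: extend u to a morphism of triangles to 0 -> B -> B. *)
Lemma dist_contra B (u : Hom Y B) : u \oc f = 0 <-> exists v, u = v \oc g.
Proof.
split=> [uf0|[v ->]]; last by rewrite -comp_assoc dist_comp0 comp0r.
have [O O0] := (tr_additive T).1.
have idB : dist T (0 : Hom O B) (idm B) 0.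
  by apply (tr2 _ _ _).2; rewrite raddf0 oppr0; apply/tr1_id/susp_zero.
have [|c [cg _]] := tr3 (a := 0) (b := u) fgh idB; first by rewrite uf0 comp0r.
by exists c; rewrite cg comp_idl.
Qed.

End Triangle.

Section Cone.
Variables (X Y Z : C) (f : Hom X Y) (g : Hom Y Z) (h : Hom Z (Sg X)).
Hypothesis fgh : dist T f g h.

Lemma hom0_cone_l B q : hom0 (S^q.+1 X) B -> hom0 (S^q Y) B -> hom0 (S^q Z) B.
Proof.
move=> hX hY u; have ug : u \oc spow q g = 0 by exact: hY.
have [v ->] := (dist_contra (dist_rot (dist_spow fgh q)) u).1 ug.
by rewrite (hX v) comp0l.
Qed.

End Cone.

Lemma hom0_iter q X Y : hom0 (S^q X) (S^q Y) <-> hom0 X Y.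
Proof. by elim: q => //= q <-; exact: hom0_susp. Qed.

(** Taken with a generator on the left, this shows that an object that receives no
    nonzero map from the shifts of the generator is zero. *)
Lemma thick_hom0_l X : thick T (fun Y => forall p q, hom0 (S^p Y) (S^q X)).
Proof.
have retr Y Y' : retract Y' Y -> (forall p q, hom0 (S^p Y) (S^q X)) ->
    forall p q, hom0 (S^p Y') (S^q X).
  by move=> /retract_iter r h p q; exact: hom0_retractl (r p) (h p q).
split.
- by move=> Z Z0 p q; apply/is_zero_homl/iter_susp_zero.
- by move=> Y h p q; rewrite -iterSr; exact: h.
- move=> Y h p q; apply/hom0_susp; rewrite -!iterS iterSr.
  have r := retract_iso (isomorphic_sym (susp_desusp_iso Y)).
  exact: hom0_retractl (retract_iter p r) (h p q.+1).
- by move=> A B Z f g h fgh hA hB p q; exact: (hom0_cone_l fgh).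
- by move=> Y Y' /retract_iso; exact: retr.
- by move=> Y Y' Y'' /retract_summand; exact: retr.
Qed.

(** * Classes in the Grothendieck group *)

Definition K0_class X : K0 T := quotient_pi _ (K0sp_class X).

Lemma K0_class_dist X Y Z (f : Hom X Y) (g : Hom Y Z) (h : Hom Z (Sg X)) :
  dist T f g h -> K0_class Y = K0_class X + K0_class Z.
Proof.
move=> fgh; have : K0_class X - K0_class Y + K0_class Z = 0.
  rewrite -quotient_piB -quotient_piD; apply: quotient_pi_eq0.
  by exists X, Y, Z, f, g, h.
by move/eqP; rewrite addrAC subr_eq0 => /eqP.
Qed.

Lemma K0_class_zero Z : is_zero Z -> K0_class Z = 0.
Proof.
move=> Z0; apply: (addrI (K0_class Z)); rewrite addr0.
by rewrite -(K0_class_dist (tr1_id T Z Z0)).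
Qed.

Lemma K0_class_susp X : K0_class (Sg X) = - K0_class X.
Proof.
have [O O0] := (tr_additive T).1.
apply/eqP; rewrite -addr_eq0 addrC; apply/eqP.
by rewrite -(K0_class_dist (dist_rot (tr1_id T X O0))) K0_class_zero.
Qed.

Lemma K0_class_iter q X : K0_class (S^q X) = K0_class X *~ (-1) ^+ q.
Proof.
elim: q => [|q IHq] /=; first by rewrite expr0.
by rewrite K0_class_susp IHq exprS mulN1r mulrNz.
Qed.

(** Stated as an induction principle for the elements of K0. *)
Lemma K0_classes_generate (H : K0 T -> Prop) : H 0 ->
  (forall x y, H x -> H y -> H (x + y)) ->
  (forall X c, H (K0_class X *~ c)) -> forall x, H x.
Proof.
move=> H0 HD Hc x; have [y ->] := quotient_pi_surj x.
have [z ->] := quotient_pi_surj y.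
rewrite -[z]freeg_sumE; elim/big_rec: _ => [|X w _ Hw].
  by rewrite !quotient_pi0.
rewrite !quotient_piD; apply: HD => //.
have <- : free_class (repr X : C) *~ coeff X z = << coeff X z *g X >>.
  by rewrite /free_class /class_of reprK freegU_mulz intz.
rewrite !quotient_piMz; exact: Hc.
Qed.

(** A single chi m need not be additive, so it need not be defined on K0; but a relation
    [s] *~ c = 0 in K0 involves finitely many triangles and biproducts, and a large
    m respects all of them. *)
Lemma K0_class_infinite_order (chi : nat -> C -> int) (s : C) :
  (forall X Y S, biproduct X Y S ->
     eventually (fun m => chi m S = chi m X + chi m Y)) ->
  (forall X Y Z (f : Hom X Y) (g : Hom Y Z) (h : Hom Z (Sg X)), dist T f g h ->
     eventually (fun m => chi m Y = chi m X + chi m Z)) ->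
  eventually (fun m => chi m s = 1) ->
  forall c, K0_class s *~ c = 0 -> c = 0.
Proof.
move=> chi_bip chi_dist chi_s c.
have [O O0] := (tr_additive T).1.
have chi_O : eventually (fun m => chi m O = 0).
  apply: eventually_mono (chi_dist _ _ _ _ _ _ (tr1_id T O O0)) => m e.
  by apply: (addrI (chi m O)); rewrite -e addr0.
have chi_iso X Y : isomorphic X Y -> eventually (fun m => chi m Y = chi m X).
  move=> [f [g [gf fg]]].
  have bip : biproduct X O Y.
    exists f, 0, g, 0; rewrite !comp0r !comp0l addr0.
    by split=> //; rewrite O0.
  apply: eventually_mono (eventually_and chi_O (chi_bip _ _ _ bip)) => m [e1 ->].
  by rewrite e1 addr0.
(* chi m is transported to isomorphism classes through representatives; the
   result agrees with chi m only for m large, depending on the object *)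
pose phi m : F_iso C -> int^o := fglift (fun x : iso_class C => chi m (repr x : C) : int^o).
have phiB m : {morph phi m : x y / x - y}.
  exact: lift_is_additive.
have phi0 m : phi m 0 = 0 by rewrite -(subrr 0) phiB subrr.
have phiD m : {morph phi m : x y / x + y}.
  by move=> x y; rewrite -[y in LHS]opprK -[- y]sub0r !phiB phi0 sub0r opprK.
have phi_free X : eventually (fun m => phi m (free_class X) = chi m X).
  have /chi_iso : isomorphic (repr (class_of X) : C) X.
    by apply/asboolP; rewrite -/(isob _ _); apply/eqmodP; rewrite reprK.
  by apply: eventually_mono => m ->; rewrite /phi /free_class liftU scale1r.
pose H0 x := eventually (fun m => phi m x = 0).
have H00 : H0 0 by exists 0%N => m _; exact: phi0.
have H0B x y : H0 x -> H0 y -> H0 (x - y).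
  move=> hx hy; apply: eventually_mono (eventually_and hx hy) => m [ex ey].
  by rewrite phiB ex ey subrr.
have free_bip X Y S : biproduct X Y S -> H0 (free_class S - free_class X - free_class Y).
  move=> /chi_bip e.
  have free := eventually_and (phi_free S) (eventually_and (phi_free X) (phi_free Y)).
  apply: eventually_mono (eventually_and e free) => m [eS [e1 [e2 e3]]].
  by rewrite !phiB e1 e2 e3 eS addrAC addrK subrr.
have H0K (x y : F_iso C) : quotient_pi _ x = quotient_pi _ y :> K0sp C -> H0 (x - y).
  by move=> /quotient_pi_eq /gen_subgroupP; apply=> // _ [X [Y [S [/free_bip bip ->]]]].
(* elements of the split group with a representative that chi m kills for large m;
   they form a subgroup that contains the relations of triangles *)
pose H1 (x : K0sp C) := exists2 y, x = quotient_pi _ y & H0 y.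
move=> cs0; have : H1 (K0sp_class s *~ c).
  have : quotient_pi _ (K0sp_class s *~ c) = quotient_pi _ 0 :> K0 T.
    by rewrite quotient_piMz quotient_pi0.
  move=> /quotient_pi_eq; rewrite subr0 => /gen_subgroupP; apply.
  - by exists 0; rewrite ?quotient_pi0.
  - by move=> _ _ [x -> hx] [y -> hy]; exists (x - y); [rewrite quotient_piB | exact: H0B].
  move=> _ [X [Y [Z [f [g [h [/chi_dist e ->]]]]]]].
  exists (free_class X - free_class Y + free_class Z).
    by rewrite quotient_piD quotient_piB.
  have free := eventually_and (phi_free Y) (eventually_and (phi_free X) (phi_free Z)).
  apply: eventually_mono (eventually_and e free) => m [eY [e1 [e2 e3]]].
  by rewrite phiD phiB e1 e2 e3 eY opprD addNKr addNr.
move=> [y]; rewrite -quotient_piMz => /H0K hy Hy.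
have [M hM] := eventually_and (eventually_and hy Hy) (eventually_and (phi_free s) chi_s).
have [[e1 e2] [e3 e4]] := hM M (leqnn M).
move: e1; rewrite phiB e2 subr0.
have -> : phi M (free_class s *~ c) = phi M (free_class s) *~ c.
  pose Phi : {additive _ -> _} :=
    HB.pack (phi M) (GRing.isZmodMorphism.Build _ _ (phi M) (phiB M)).
  exact: (raddfMz Phi).
by rewrite e3 e4 intz.
Qed.

End Triangulated.

Section Cyclic.
Variables (C : preadditive) (T : triangulated C).

Lemma K0_infinite_cyclic (s : C) :
  (forall X, exists c, K0_class T X = K0_class T s *~ c) ->
  (forall c, K0_class T s *~ c = 0 -> c = 0) ->
  exists f : {additive K0 T -> int}, bijective f.
Proof.
move=> gen inf.
have /choice[f fE] (x : K0 T) : exists c, x = K0_class T s *~ c.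
  elim/(K0_classes_generate (T := T)): x => [|x y [a ->] [b ->]|X c].
  - by exists 0.
  - by exists (a + b); rewrite mulrzDr.
  - by have [d ->] := gen X; exists (d * c); rewrite mulrzA.
have inj a b : K0_class T s *~ a = K0_class T s *~ b -> a = b.
  move=> /eqP; rewrite -subr_eq0 -mulrzBr => /eqP /inf /eqP.
  by rewrite subr_eq0 => /eqP.
have fB : zmod_morphism f.
  by move=> x y; apply: inj; rewrite -fE mulrzBr -!fE.
pose F : {additive _ -> _} := HB.pack f (GRing.isZmodMorphism.Build _ _ f fB).
exists F, (fun c => K0_class T s *~ c) => x /=; first by rewrite -fE.
by apply: inj; rewrite -fE.
Qed.

End Cyclic.

(** * Hom spaces and bounded families *)

Section Linear.
Variables (k : fieldType) (C : linear_triangulated k).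

Local Notation P := (preadditive_of C).
Local Notation T := (lt_tri C).
Local Notation Sg := (susp T).
Local Notation D := (desusp T).
Local Notation "'S^' q" := (iter q Sg) (at level 9, q at level 9).
Implicit Types X Y Z A B : P.

Definition post A X Y (f : @Hom P X Y) : lHom A X -> lHom A Y := fun u => lcomp f u.
Definition pre B X Y (f : @Hom P X Y) : lHom Y B -> lHom X B := fun u => lcomp u f.
Arguments post A [X Y] f _.
Arguments pre B [X Y] f _.

Lemma post_linear A X Y (f : @Hom P X Y) : linear (post A f).
Proof. by move=> a u v; rewrite /post lcomp_addr lcomp_scaler. Qed.

Lemma pre_linear B X Y (f : @Hom P X Y) : linear (pre B f).
Proof. by move=> a u v; rewrite /pre lcomp_addl lcomp_scalel. Qed.

HB.instance Definition _ A X Y (f : @Hom P X Y) :=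
  GRing.isLinear.Build k _ _ _ (post A f) (@post_linear A X Y f).
HB.instance Definition _ A X Y (f : @Hom P X Y) :=
  GRing.isLinear.Build k _ _ _ (pre A f) (@pre_linear A X Y f).

Local Notation hdim A X := (dim (lHom A X)).
Local Notation hdim_le A X := (dim_le (lHom A X)).

Lemma post_exact A X Y Z (f : @Hom P X Y) (g : @Hom P Y Z) (h : @Hom P Z (Sg X)) :
  dist T f g h -> exact (post A f) (post A g).
Proof. by move=> fgh u; exact: (dist_cov fgh). Qed.

Lemma post_inj A X Y (f : @Hom P X Y) (u : @Hom P Y X) :
  u \oc f = idm X -> forall v, post A f v = 0 -> v = 0.
Proof.
move=> uf v fv; have e : f \oc v = 0 := fv.
by rewrite -[v](@comp_idl P) -uf -comp_assoc e comp0r.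
Qed.

Lemma hdim_le_retract A X Y b : retract X Y -> hdim_le A Y b -> hdim_le A X b.
Proof. by move=> [i [r ri]]; apply: (dim_le_inj (f := post A i)); exact: post_inj ri. Qed.

(** The split exact sequence of the biproduct stays exact under Hom(A, -). *)
Lemma hdim_biproduct A X Y S b : @biproduct P X Y S -> hdim_le A S b ->
  hdim A S = (hdim A X + hdim A Y)%N.
Proof.
move=> bip hS; have hX := hdim_le_retract (retract_summand bip) hS.
have [i1 [i2 [p1 [p2 [e11 e22 e21 e12 e]]]]] := bip.
have hY : hdim_le A Y b by apply: hdim_le_retract hS; exists i2, p2.
have ex : exact (post A i1) (post A p2).
  move=> u; split=> [p2u|[v ->]]; last first.
    by rewrite /post lcomp_assoc; have -> : lcomp p2 i1 = 0 := e21; exact: (@comp0l P).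
  exists (lcomp p1 u); rewrite /post -[LHS](@comp_idl P) -e comp_addl -!comp_assoc.
  have -> : p2 \oc u = 0 := p2u.
  by rewrite comp0r addr0.
rewrite (dim_exact ex hS) (rank_inj (post_inj e11) hX) (rank_surj _ hY) // => v.
exists (lcomp i2 v); rewrite /= /post lcomp_assoc.
by have -> : lcomp p2 i2 = lidm Y := e22; rewrite lcomp_idl.
Qed.

Lemma hdim_le0 A X : hdim_le A X 0 <-> @hom0 P A X.
Proof. exact: dim_le0. Qed.

Lemma hdim_le_cone A X Y Z (f : @Hom P X Y) (g : @Hom P Y Z) (h : @Hom P Z (Sg X))
    q a b : dist T f g h -> hdim_le A (S^q Y) a -> hdim_le A (S^q.+1 X) b ->
  hdim_le A (S^q Z) (a + b).
Proof.
move=> fgh.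
apply: (@dim_le_exact k _ _ _ (post A (spow T q g)) (post A (hpow q h))).
exact: (post_exact (dist_rot (dist_spow fgh q))).
Qed.

(** Families of test objects A i, together with a region [gap L i q] of degrees that
    shrinks as L grows. *)
Section Bounded.
Variables (I : Type) (A : I -> P) (gap : nat -> I -> nat -> bool).
Hypothesis gap_shift : forall L L' i q q', gap L' i q' -> (L < L')%N ->
  (q <= q'.+1)%N -> (q' <= q.+1)%N -> gap L i q.

(** The bound D has to be uniform in i: it later bounds the starting value of an
    induction, and the test object is chosen after the number of steps. The
    restriction to q >= L makes the class closed under desuspension while only
    nonnegative powers of the suspension are ever written. *)
Definition bounded X : Prop :=
  exists L D, forall i q, (L <= q)%N ->
    hdim_le (A i) (S^q X) (if gap L i q then 0 else D).

Lemma bounded_shift X : bounded X ->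
  exists L D, forall L' D' i q q', (L < L')%N -> (D <= D')%N -> (L <= q)%N ->
    (q <= q'.+1)%N -> (q' <= q.+1)%N ->
    hdim_le (A i) (S^q X) (if gap L' i q' then 0 else D').
Proof.
move=> [L [d h]]; exists L, d => L' D' i q q' LL DD Lq q1 q2.
apply: dim_leW _ (h i q Lq); have [r|_] := ifP (gap L' i q').
  by rewrite (gap_shift r).
by case: ifP.
Qed.

(** Each operation moves degrees by at most one, which is absorbed by enlarging L;
    for cones the two bounds D add up. *)
Lemma thick_bounded : thick T bounded.
Proof.
have retr X Y : retract Y X -> bounded X -> bounded Y.
  move=> r [L [d h]]; exists L, d => i q Lq.
  exact: hdim_le_retract (retract_iter T q r) (h i q Lq).
split.
- move=> Z Z0; exists 0%N, 0%N => i q _; apply: (dim_leW (leq0n _)).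
  by apply (hdim_le0 _ _).2; apply/is_zero_homr/iter_susp_zero.
- move=> X /bounded_shift[L [d h]]; exists L.+1, d => i q Lq.
  by rewrite -iterSr; apply: h => //; lia.
- move=> X /bounded_shift[L [d h]]; exists L.+1, d => i [//|q] Lq.
  have r := retract_iter T q (retract_iso (isomorphic_sym (susp_desusp_iso T X))).
  by rewrite iterSr; apply: (hdim_le_retract r); apply: h => //; lia.
- move=> X Y Z f g h fgh /bounded_shift[L [d hX]] /bounded_shift[L' [d' hY]].
  exists (maxn L L').+1, (d' + d)%N => i q Lq.
  pose M := (maxn L L').+1.
  have := hdim_le_cone fgh (hY M d' i q q _ _ _ _ _) (hX M d i q.+1 q _ _ _ _ _).
  by rewrite -/M; case: gap; apply; rewrite /M; lia.
- by move=> X Y /retract_iso; exact: retr.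
- by move=> X Y S /retract_summand; exact: retr.
Qed.

End Bounded.

End Linear.

Arguments post {k C} A [X Y] f _.
Arguments pre {k C} B [X Y] f _.

(** * The tower over a spherical object *)

Section Line.
Variable k : fieldType.
Implicit Types V W : lmodType k.

Definition line V : Prop := exists2 v0 : V, v0 != 0 & forall v, exists c, v = c *: v0.

Lemma line_gen V (x : V) : line V -> x != 0 -> forall v, exists c, v = c *: x.
Proof.
move=> [v0 v0nz gen] xnz v; have [a xE] := gen x; have [b ->] := gen v.
have anz : a != 0 by apply: contraNneq xnz => a0; rewrite xE a0 scale0r.
by exists (b / a); rewrite xE scalerA divfK.
Qed.

Lemma line_bij V W (f : {linear V -> W}) : (forall v, f v = 0 -> v = 0) ->
  (forall w, exists v, w = f v) -> line V <-> line W.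
Proof.
move=> f_inj f_surj; split=> [[v0 nz gen]|[w0 nz gen]].
  exists (f v0) => [|w]; first by apply: contra_neq nz => /f_inj.
  by have [v ->] := f_surj w; have [c ->] := gen v; exists c; rewrite linearZ.
have [v0 w0E] := f_surj w0; exists v0 => [|v].
  by apply: contra_neq nz => v00; rewrite w0E v00 linear0.
have [c e] := gen (f v); exists c; apply/eqP; rewrite -subr_eq0; apply/eqP/f_inj.
by rewrite linearB linearZ /= e w0E subrr.
Qed.

Lemma has_dim1_line V : has_dim V 1 -> line V.
Proof.
move=> [f [g fK gK]]; have f_inj v : f v = 0 -> v = 0.
  by move=> e; rewrite -[v]fK e -(linear0 f) fK.
apply/(line_bij f_inj); first by move=> w; exists (g w); rewrite gK.
exists (const_mx 1) => [|v].
  by apply/eqP => /matrixP/(_ 0 0); rewrite !mxE; apply/eqP/oner_neq0.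
by exists (v 0 0); apply/matrixP=> i j; rewrite !ord1 !mxE mulr1.
Qed.

Lemma has_dim0 V : has_dim V 0 -> forall v : V, v = 0.
Proof. by move=> [f [g fK gK]] v; rewrite -[v]gK thinmx0 linear0. Qed.

Lemma dim_line V : line V -> is_dim (fun _ : V => True) 1.
Proof. by move=> [v0 nz gen]; exact: is_dim1 nz gen. Qed.

End Line.

Section Tower.
Variables (k : fieldType) (C : linear_triangulated k).

Local Notation P := (preadditive_of C).
Local Notation T := (lt_tri C).
Local Notation Sg := (susp T).
Local Notation D := (desusp T).
Local Notation "'S^' q" := (iter q Sg) (at level 9, q at level 9).
Implicit Types X Y Z A B : P.

Definition suspl X Y : lHom X Y -> lHom (Sg X) (Sg Y) := @fmap P P Sg X Y.

Lemma suspl_linear X Y : linear (@suspl X Y).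
Proof. by move=> a u v; rewrite /suspl raddfD lt_susp_scale. Qed.

HB.instance Definition _ X Y :=
  GRing.isLinear.Build k _ _ _ (@suspl X Y) (@suspl_linear X Y).

Lemma line_susp X Y : line (lHom X Y) <-> line (lHom (Sg X) (Sg Y)).
Proof.
apply: (line_bij (f := @suspl X Y)) => [v|w]; first exact: (@susp_faithful P T X Y v).
by have [f fE] := @susp_full P T X Y w; exists f; rewrite -fE.
Qed.

Lemma hom0_iter_desusp m A B : @hom0 P A (iter m D B) -> @hom0 P (S^m A) B.
Proof.
elim: m A => //= m IHm A /(hom0_susp T _ _).2 h; rewrite -iterS iterSr; apply: IHm.
exact: hom0_retractr (retract_iso (susp_desusp_iso T _)) h.
Qed.

Variable s : P.

(** The integer degree q - p is written as a pair of natural numbers, so that negative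
    degrees need no negative powers of the suspension. *)
Definition two_lines (a b : nat) X : Prop := forall p q,
  if (q == p + a)%N || (q == p + b)%N then line (lHom (S^p X) (S^q s))
  else @hom0 P (S^p X) (S^q s).

(** Full faithfulness reduces to the case where p or q is zero. For q = 0 < p the
    powers of the suspension are moved to the right as desuspensions. *)
Lemma spherical_two_lines m : spherical m.+1 s -> two_lines 0 m.+1 s.
Proof.
move=> sph; elim=> [|p IHp] [|q].
- exact/has_dim1_line/(sph (Posz 0)).
- have := sph (Posz q.+1); rewrite !add0n /= eqz_nat.
  by case: eqP => _ => [/has_dim1_line | /has_dim0].
- by rewrite !addSn /=; apply: (hom0_iter_desusp (m := p.+1)); apply: has_dim0 (sph (Negz p)).
- rewrite !addSn !eqSS; have := IHp q; case: ifP => _.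
    by move/(line_susp _ _).1.
  by move/(hom0_susp T _ _).2.
Qed.

Section Step.
Variables (p e : nat) (E : P) (xi : @Hom P (S^p E) (S^p (S^e s))).
Hypothesis xi_nz : xi <> 0.

(** In this degree the source line is spanned by the identity of S^(p+e) s, which is
    sent to xi. *)
Lemma precomp_line_inj q (w : @Hom P (S^p (S^e s)) (S^q s)) : q = (p + e)%N ->
  line (lHom (S^p (S^e s)) (S^q s)) -> w \oc xi = 0 -> w = 0.
Proof.
move=> qE; subst q; rewrite iterD in w * => ln wxi.
have [id0|idn] := eqVneq (lidm (S^p (S^e s))) 0.
  exact: (@is_zero_homr P).
have [c wE] := line_gen ln idn w.
rewrite wE in wxi *.
move/eqP: wxi; rewrite /comp /= lcomp_scalel lcomp_idl scaler_eq0 => /orP[/eqP->|/eqP//].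
by rewrite scale0r.
Qed.

Lemma precomp_line_surj q (v : @Hom P (S^p E) (S^q s)) : q = (p + e)%N ->
  line (lHom (S^p E) (S^q s)) -> exists w, v = w \oc xi.
Proof.
move=> qE; subst q; rewrite iterD in v * => ln.
have [c vE] := line_gen ln (introN eqP xi_nz) v.
exists (c *: lidm _ : lHom _ _).
by rewrite vE /comp /= lcomp_scalel lcomp_idl.
Qed.

End Step.

Lemma pre_line X Y B (f : @Hom P X Y) :
  (forall u : @Hom P Y B, u \oc f = 0 -> u = 0) ->
  (forall v : @Hom P X B, exists u, v = u \oc f) ->
  line (lHom Y B) <-> line (lHom X B).
Proof. exact: (line_bij (f := pre B f)). Qed.

Variable n : nat.
Hypothesis n_gt0 : (0 < n)%N.
Hypothesis s_lines : two_lines 0 n.+1 s.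

Local Notation topdeg i := (n.+1 * i.+1)%N.

Lemma s_hom0 p e q : q <> (p + e)%N -> q <> (p + e + n.+1)%N ->
  @hom0 P (S^p (S^e s)) (S^q s).
Proof.
move=> q1 q2; rewrite -iterD; have := s_lines (p + e) q.
by case: ifP => //; rewrite addn0; lia.
Qed.

Lemma s_line p e q : q = (p + e)%N \/ q = (p + e + n.+1)%N ->
  line (lHom (S^p (S^e s)) (S^q s)).
Proof.
move=> qE; rewrite -iterD; have := s_lines (p + e) q.
by case: ifP => //; rewrite addn0; lia.
Qed.

Lemma two_lines_hom0 i E p q : two_lines i (topdeg i) E ->
  q <> (p + i)%N -> q <> (p + topdeg i)%N -> @hom0 P (S^p E) (S^q s).
Proof. by move=> /(_ p q); case: ifP => //; lia. Qed.

Lemma two_lines_line i E p q : two_lines i (topdeg i) E ->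
  q = (p + i)%N \/ q = (p + topdeg i)%N -> line (lHom (S^p E) (S^q s)).
Proof. by move=> /(_ p q); case: ifP => //; lia. Qed.

(** In the long exact sequence of Hom(-, S^q s), the line of S^(topdeg i) s in its
    lower degree cancels against the upper line of E, because xi is not zero. What
    is left is the lower line of E, shifted by one, and the upper line of
    S^(topdeg i) s. *)
Lemma cone_two_lines i (E E' : P) (xi : @Hom P E (S^(topdeg i) s))
    (ga : @Hom P (S^(topdeg i) s) E') (de : @Hom P E' (Sg E)) :
  two_lines i (topdeg i) E -> xi <> 0 -> dist T xi ga de ->
  two_lines i.+1 (topdeg i.+1) E'.
Proof.
move=> hE xi_nz d p q.
have dp := dist_spow d p.
have xip_nz r : spow T r xi <> 0 by move=> /spow_eq0.
have gaP := dist_contra (dist_rot dp).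
have deP := dist_contra (dist_rot (dist_rot dp)).
have xiP := dist_contra dp.
have lt_i_topdeg : (i.+1 < topdeg i)%N by nia.
have topdegS : topdeg i.+1 = (topdeg i + n.+1)%N by nia.
case: ifP => [/orP[/eqP qE|/eqP qE]|/norP[/eqP q1 /eqP q2]].
- apply/(@pre_line _ _ _ (hpow p de)) => [u /deP[v ->]|v|].
  + by rewrite (@s_hom0 p.+1 (topdeg i) q _ _ v) ?comp0l //; lia.
  + by apply/gaP; apply: (@s_hom0 p (topdeg i) q); lia.
  + by apply: (@two_lines_line i E p.+1 q hE); lia.
- apply/(@pre_line _ _ _ (spow T p ga)) => [u /gaP[v ->]|v|].
  + by rewrite (@two_lines_hom0 i E p.+1 q hE _ _ v) ?comp0l //; lia.
  + by apply/xiP; apply: (@two_lines_hom0 i E p q hE); lia.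
  + by apply: (@s_line p (topdeg i) q); lia.
move=> u; have /gaP[v ->] : u \oc spow T p ga = 0.
  have [qE|qN] := eqVneq q (p + topdeg i)%N.
    apply: (precomp_line_inj (xip_nz p) qE).
      by apply: s_line; left.
    by rewrite -comp_assoc (dist_comp0 dp) comp0r.
  by apply: (@s_hom0 p (topdeg i) q); lia.
have [qE|qN] := eqVneq q (p.+1 + topdeg i)%N.
  have [|w ->] := precomp_line_surj (xip_nz p.+1) v qE.
    by apply: (@two_lines_line i E p.+1 q hE); right.
  have e0 : spow T p.+1 xi \oc hpow p de = 0 := dist_comp0 (dist_rot (dist_rot dp)).
  by rewrite -comp_assoc e0 comp0r.
by rewrite (@two_lines_hom0 i E p.+1 q hE _ _ v) ?comp0l //; lia.
Qed.

Definition tower_step i (E E' : P) : Prop :=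
  exists (xi : @Hom P E (S^(topdeg i) s)) (ga : @Hom P (S^(topdeg i) s) E')
    (de : @Hom P E' (Sg E)), xi <> 0 /\ dist T xi ga de.

Lemma tower_exists : exists E : nat -> P, [/\ E 0%N = s,
  forall i, two_lines i (topdeg i) (E i) & forall i, tower_step i (E i) (E i.+1)].
Proof.
(* choice needs a successor for every object, so one that is not a stage of the
   tower gets itself as a dummy value *)
have /choice[next nextP] (iE : nat * P) : exists E',
    two_lines iE.1 (topdeg iE.1) iE.2 ->
    two_lines iE.1.+1 (topdeg iE.1.+1) E' /\ tower_step iE.1 iE.2 E'.
  case: iE => i E /=; case: (pselect (two_lines i (topdeg i) E)) => [hE|]; last by exists E.
  have := two_lines_line (p := 0) hE (or_intror erefl).
  move=> [xi /eqP xi_nz _]; have [E' [ga [de d]]] := @tr1_cone P T _ _ xi.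
  exists E' => _; split; first exact: cone_two_lines hE xi_nz d.
  by exists xi, ga, de.
pose E := fix E i := if i is j.+1 then next (j, E j) else s.
have hE i : two_lines i (topdeg i) (E i).
  elim: i => [|i /(nextP (i, E i))[]] //=.
  by rewrite muln1.
by exists E; split=> // i; case: (nextP (i, E i) (hE i)).
Qed.

End Tower.

(** * Maps from the tower *)

Section Invariants.
Variables (k : fieldType) (C : linear_triangulated k).

Local Notation P := (preadditive_of C).
Local Notation T := (lt_tri C).
Local Notation Sg := (susp T).
Local Notation "'S^' q" := (iter q Sg) (at level 9, q at level 9).
Local Notation hdim A X := (dim (lHom A X)).
Local Notation hdim_le A X := (dim_le (lHom A X)).
Local Notation topdeg n i := (n.+1 * i.+1)%N.
Implicit Types X Y Z A B : P.

Variables (s : P) (n : nat) (E : nat -> P).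
Hypothesis n_gt0 : (0 < n)%N.
Hypothesis s_lines : two_lines s 0 n.+1 s.
Hypothesis s_gen : classically_generated T s.
Hypothesis E0 : E 0%N = s.
Hypothesis E_lines : forall i, two_lines s i (topdeg n i) (E i).
Hypothesis E_step : forall i, tower_step s n i (E i) (E i.+1).

(** The map is the composite of the connecting maps S^p E_j -> S^(p+1) E_(j-1) -> ... .
    A map that it kills factors, at some stage, through a shift of s beyond
    S^(p+j) s, so it vanishes when no such shift maps to B. In the module picture,
    an element of lowest degree is killed by t, and the quotient map from a
    truncation of k[t] to k stays nonzero after composing with it. *)
Lemma tower_proj j p : exists pi : @Hom P (S^p (E j)) (S^(p + j) s),
  forall B, (forall p', (p + j < p')%N -> @hom0 P (S^p' s) B) ->
  forall u : @Hom P (S^(p + j) s) B, u \oc pi = 0 -> u = 0.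
Proof.
elim: j p => [|j IHj] p.
  by rewrite E0 addn0; exists (idm _) => B _ u; rewrite comp_idr.
rewrite addnS -addSn; have [pi piP] := IHj p.+1.
have [xi [ga [de [_ d]]]] := E_step j.
have dp := dist_spow d p.
exists (pi \oc hpow p de) => B hB u; rewrite comp_assoc.
move/(dist_contra (dist_rot (dist_rot dp))) => [v uE].
apply: (piP B hB); rewrite uE.
have -> : v = 0; last exact: comp0l.
by apply: (_ : @hom0 P (S^p.+1 (S^(topdeg n j) s)) B); rewrite -iterD; apply: hB; nia.
Qed.

(** The projection itself is detected by B = S^i s, so it is nonzero and spans the line
    Hom(E_i, S^i s). *)
Lemma tower_gen i : exists pi : @Hom P (E i) (S^i s),
  (forall B, (forall p', (i < p')%N -> @hom0 P (S^p' s) B) ->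
    forall u : @Hom P (S^i s) B, u \oc pi = 0 -> u = 0) /\
  forall u : lHom (E i) (S^i s), exists c, u = c *: (pi : lHom _ _).
Proof.
have [pi piP] := tower_proj i 0; exists pi; split=> //.
have ln : line (lHom (E i) (S^i s)).
  by have := E_lines i 0 i; rewrite add0n eqxx.
apply: line_gen => //; apply/eqP => pi0.
have id0 : is_zero (S^i s : P).
  apply: piP; last by rewrite pi0 comp0r.
  by move=> p' ip'; have := s_lines p' i; case: ifP => //; lia.
by have [v /eqP nz _] := ln; case: nz; exact: (@is_zero_homr P _ _ id0 v).
Qed.

(** Degrees at distance at least L from i and not beyond 2i - L, hence below the
    second line, which sits in degree (n+1)(i+1). *)
Definition tower_gap L i q := ((q + L <= i) || ((i + L <= q) && (q + L <= 2 * i)))%N.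
Definition sphere_gap L p q := (q + L <= p)%N.

Lemma bounded_tower X : bounded E tower_gap X.
Proof.
apply: s_gen.
  by apply: thick_bounded => L L' i q q'; rewrite /tower_gap; lia.
exists 1%N, 1%N => i q _; have := E_lines i 0 q; rewrite !add0n /tower_gap.
case: ifP => [qE|_ h0]; last first.
  by apply: dim_leW (leq0n _) _; apply (hdim_le0 _ _).2.
case: ifP => [|_ ln]; last by exists 1%N => //; exact: dim_line.
by move: qE; nia.
Qed.

Lemma bounded_sphere X : bounded (fun p => S^p s : P) sphere_gap X.
Proof.
apply: s_gen.
  by apply: thick_bounded => L L' i q q'; rewrite /sphere_gap; lia.
exists 1%N, 1%N => p q _; have := s_lines p q; rewrite /sphere_gap.
case: ifP => [qE|_ h0]; last first.
  by apply: dim_leW (leq0n _) _; apply (hdim_le0 _ _).2.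
case: ifP => [|_ ln]; last by exists 1%N => //; exact: dim_line.
by move: qE; lia.
Qed.

(** * Window sums *)

(** For w = -1 an Euler characteristic, for w = 1 a total dimension. With i = 2m, the
    window [m, 3m) contains any neighbourhood of the degree 2m of the cohomology,
    and stays away from the second line of the tower, for large m. *)
Definition window_sum (w : int) m X : int :=
  \sum_(m <= q < 3 * m) w ^+ q * (hdim (E (2 * m)) (S^q X))%:Z.

Lemma eventually_fin X : exists D, eventually (fun m => forall q, (m <= q)%N ->
  hdim_le (E (2 * m)) (S^q X) D).
Proof.
have [L [D h]] := bounded_tower X; exists D, L => m Lm q mq.
by apply: dim_leW (h (2 * m)%N q (leq_trans Lm mq)); case: ifP.
Qed.

Lemma eventually_edge X : exists L, eventually (fun m =>
  forall q, (m <= q.+1)%N -> (q <= (3 * m).+1)%N ->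
  (q + L <= 2 * m)%N || (2 * m + L <= q)%N ->
  hdim_le (E (2 * m)) (S^q X) 0).
Proof.
have [L [D h]] := bounded_tower X; exists L, L.+1 => m Lm q mq qm out.
have r : tower_gap L (2 * m) q by rewrite /tower_gap; lia.
by have := h (2 * m)%N q; rewrite r; apply; lia.
Qed.

Lemma window_sum_biproduct w X Y S : @biproduct P X Y S ->
  eventually (fun m => window_sum w m S = window_sum w m X + window_sum w m Y).
Proof.
move=> bip; have [D fin] := eventually_fin S; apply: eventually_mono fin => m fin.
rewrite /window_sum -big_split; apply: eq_big_nat => q /andP[mq _] /=.
by rewrite (hdim_biproduct (biproduct_iter T q bip) (fin q mq)) PoszD mulrDr.
Qed.

(** Each dimension is a sum of two ranks, and the ranks of the connecting maps h are
    the only ones that do not cancel. They telescope, up to the two connecting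
    maps at the ends of the window, which start in zero spaces. *)
Lemma window_sum_dist X Y Z (f : @Hom P X Y) (g : @Hom P Y Z) (h : @Hom P Z (Sg X)) :
  dist T f g h ->
  eventually (fun m => window_sum (-1) m Y = window_sum (-1) m X + window_sum (-1) m Z).
Proof.
move=> fgh.
have [DX finX] := eventually_fin X; have [DY finY] := eventually_fin Y.
have [DZ finZ] := eventually_fin Z; have [L edge] := eventually_edge Z.
have big_m : eventually (fun m => L < m)%N by exists L.+1.
apply: eventually_mono (eventually_and (eventually_and finX finY)
  (eventually_and finZ (eventually_and edge big_m))) => m.
move=> [[fX fY] [fZ [eZ Lm]]].
pose rf q := rank (post (E (2 * m)) (spow T q f)).
pose rg q := rank (post (E (2 * m)) (spow T q g)).
pose rh q := rank (post (E (2 * m)) (hpow q h)).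
have rh0 q : (m <= q.+1)%N -> (q <= (3 * m).+1)%N ->
    (q + L <= 2 * m)%N || (2 * m + L <= q)%N -> rh q = 0%N.
  by move=> q1 q2 q3; apply/rank_eq0_l/eZ.
pose t q : int := - ((-1) ^+ q.-1 * (rh q.-1)%:Z).
suff sumE : window_sum (-1) m Y - (window_sum (-1) m X + window_sum (-1) m Z)
    = t (3 * m)%N - t m.
  apply/eqP; rewrite -subr_eq0 sumE /t !rh0 ?mulr0 ?subrr //; lia.
rewrite -telescope_sumr; last by lia.
rewrite /window_sum -big_split -sumrB; apply: eq_big_nat => q /andP[mq q3m] /=.
have q_gt0 : (0 < q)%N by lia.
have dq := dist_spow fgh q.
rewrite (dim_exact (post_exact (A := E (2 * m)) dq) (fY q mq)).
rewrite (dim_exact (post_exact (A := E (2 * m)) (dist_rot dq)) (fZ q mq)).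
have -> : hdim (E (2 * m)) (S^q X) = (rh q.-1 + rf q)%N.
  case: q q_gt0 {dq} mq q3m => // q _ mq q3m.
  have dq := dist_rot (dist_rot (dist_spow fgh q)).
  exact: (dim_exact (post_exact (A := E (2 * m)) dq) (fX q.+1 mq)).
rewrite -/(rf q) -/(rg q) -/(rh q) /t /= !PoszD.
case: q q_gt0 {dq mq q3m} => // q _; rewrite /= exprS.
by set x := (-1) ^+ q; set a := Posz _; set b := Posz _; lia.
Qed.

Lemma window_sum_sphere w : w ^+ 2 = 1 -> eventually (fun m => window_sum w m s = 1).
Proof.
move=> w2; exists 1%N => m m_gt0.
have zero q : (m <= q)%N -> (q < 3 * m)%N -> q != (2 * m)%N ->
    hdim (E (2 * m)) (S^q s) = 0%N.
  move=> mq q3m /eqP qN; apply/dim_eq0/hdim_le0; have := E_lines (2 * m) 0 q.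
  by case: ifP => //; rewrite !add0n; nia.
have one : hdim (E (2 * m)) (S^(2 * m) s) = 1%N.
  by apply/dim_ofE/dim_line; have := E_lines (2 * m) 0 (2 * m); rewrite add0n eqxx.
rewrite /window_sum (@big_cat_nat _ _ _ (2 * m)) /=; [|lia|lia].
rewrite [X in X + _]big_nat_cond big1 ?add0r; last first.
  by move=> q; rewrite andbT => /andP[mq qm]; rewrite zero ?mulr0 //; lia.
rewrite big_ltn; last by lia.
rewrite big_nat_cond big1 ?addr0; last first.
  by move=> q; rewrite andbT => /andP[mq qm]; rewrite zero ?mulr0 //; lia.
by rewrite one mulr1 exprM w2 expr1n.
Qed.

(** Suspending shifts the window by one, and the terms at its ends are zero. *)
Lemma window_sum_susp X : eventually (fun m => window_sum 1 m (Sg X) = window_sum 1 m X).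
Proof.
have [L edge] := eventually_edge X.
have big_m : eventually (fun m => L < m)%N by exists L.+1.
apply: eventually_mono (eventually_and edge big_m) => m [eX Lm].
have e0 q : (m <= q.+1)%N -> (q <= (3 * m).+1)%N ->
    (q + L <= 2 * m)%N || (2 * m + L <= q)%N -> hdim (E (2 * m)) (S^q X) = 0%N.
  by move=> q1 q2 q3; apply/dim_eq0/eX.
rewrite /window_sum; under eq_bigr do rewrite expr1n mul1r -iterSr.
under [RHS]eq_bigr do rewrite expr1n mul1r.
rewrite -(big_add1 _ _ m (3 * m).+1 xpredT (fun q => (hdim (E (2 * m)) (S^q X))%:Z)).
rewrite [RHS]big_ltn; last by lia.
by rewrite big_nat_recr /= ?(e0 m) ?(e0 (3 * m)%N) ?addr0 ?add0r //; lia.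
Qed.

Lemma window_sum_iter q X : eventually (fun m => window_sum 1 m (S^q X) = window_sum 1 m X).
Proof.
elim: q => [|q IHq]; first by exists 0%N.
by apply: eventually_mono (eventually_and IHq (window_sum_susp (S^q X))) => m [<- <-].
Qed.

(** Only the 2L degrees around 2m contribute, each at most D. *)
Lemma window_sum_bounded X : exists N : nat, eventually (fun m => window_sum 1 m X <= N%:Z).
Proof.
have [D fin] := eventually_fin X; have [L edge] := eventually_edge X.
have big_m : eventually (fun m => L < m)%N by exists L.+1.
exists (L * D + L * D)%N.
apply: eventually_mono (eventually_and fin (eventually_and edge big_m)) => m [fX [eX Lm]].
rewrite /window_sum; under eq_bigr do rewrite expr1n mul1r.
rewrite -(big_morph Posz PoszD erefl) lez_nat.
have e0 q : (m <= q.+1)%N -> (q <= (3 * m).+1)%N ->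
    (q + L <= 2 * m)%N || (2 * m + L <= q)%N -> hdim (E (2 * m)) (S^q X) = 0%N.
  by move=> q1 q2 q3; apply/dim_eq0/eX.
rewrite (@big_cat_nat _ _ _ (2 * m - L)) /=; [|lia|lia].
rewrite big_nat_cond big1 ?add0n; last first.
  by move=> q; rewrite andbT => /andP[mq qm]; apply: e0; lia.
rewrite (@big_cat_nat _ _ _ (2 * m + L)) /=; [|lia|lia].
rewrite [X in (_ + X)%N]big_nat_cond [X in (_ + X)%N]big1 ?addn0; last first.
  by move=> q; rewrite andbT => /andP[mq qm]; apply: e0; lia.
apply: (@leq_trans (\sum_(2 * m - L <= q < 2 * m + L) D)).
  rewrite !big_nat; apply: leq_sum => q /andP[q1 q2].
  by apply: dim_le_dim (fX q _); lia.
by rewrite sum_nat_const_nat -mulnDl leq_mul2r; lia.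
Qed.

(** Of the two degrees where Hom(E_i, S^(r+p) s) is a line, the upper one is excluded by
    the bound on r + p, and in the lower one the generator is the projection, whose
    composite with f is nonzero by [tower_gen]. *)
Lemma post_spow_inj p (Y : P) (f : @Hom P (S^p s) Y) : f <> 0 ->
  (forall p' q', (q' + p < p')%N -> @hom0 P (S^p' s) (S^q' Y)) ->
  forall i r, (r + p < topdeg n i)%N ->
  forall u, post (E i) (spow T r f) u = 0 -> u = 0.
Proof.
move=> f_nz low i r r_lt u fu.
have [rE|rN] := eqVneq (r + p)%N i; last first.
  have := E_lines i 0 (r + p); rewrite !add0n (negPf rN) ltn_eqF //= iterD.
  exact.
have eqS : S^i s = S^r (S^p s) :> P by rewrite -rE iterD.
have := tower_gen i; rewrite eqS => -[pi [piP gen]].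
have [c uE] := gen u; rewrite uE in fu *.
have /eqP : c *: (spow T r f \oc pi : lHom _ _) = 0.
  by move: fu; rewrite /post lcomp_scaler.
rewrite scaler_eq0 => /orP[/eqP->|/eqP fpi]; first by rewrite scale0r.
case: f_nz; apply: (@spow_eq0 P T r); apply: piP fpi => p' ip'.
by apply: low; lia.
Qed.

(** By [post_spow_inj] the long exact sequence breaks into short ones inside the
    window, so dimensions add; S^p s contributes 1. *)
Lemma cone_drop p (Y Z : P) (f : @Hom P (S^p s) Y) (g : @Hom P Y Z)
    (h : @Hom P Z (Sg (S^p s))) :
  dist T f g h -> f <> 0 ->
  (forall p' q', (q' + p < p')%N -> @hom0 P (S^p' s) (S^q' Y)) ->
  eventually (fun m => window_sum 1 m Z + 1 = window_sum 1 m Y).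
Proof.
move=> fgh f_nz low.
have [DX finX] := eventually_fin (S^p s); have [DY finY] := eventually_fin Y.
have [DZ finZ] := eventually_fin Z.
have big_m : eventually (fun m => p < m)%N by exists p.+1.
have wp := eventually_and (window_sum_iter p s) (window_sum_sphere (expr1n _ 2)).
apply: eventually_mono (eventually_and (eventually_and finX finY)
  (eventually_and finZ (eventually_and wp big_m))) => m.
move=> [[fX fY] [fZ [[e1 e2] pm]]].
rewrite -[X in _ + X]e2 -e1.
rewrite /window_sum -big_split; apply: eq_big_nat => q /andP[mq q3m] /=.
suff -> : hdim (E (2 * m)) (S^q Y) =
    (hdim (E (2 * m)) (S^q Z) + hdim (E (2 * m)) (S^q (S^p s)))%N.
  by rewrite PoszD mulrDr.
have dq := dist_spow fgh q.
rewrite (dim_exact (post_exact (A := E (2 * m)) dq) (fY q mq)).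
rewrite (dim_exact (post_exact (A := E (2 * m)) (dist_rot dq)) (fZ q mq)).
rewrite (rank_inj _ (fX q mq)); last first.
  by apply: post_spow_inj => //; nia.
rewrite (_ : rank (post _ (hpow q h)) = 0%N) ?addn0 1?addnC //.
apply: rank0 => v; apply: (post_spow_inj f_nz low (r := q.+1)); first by nia.
apply: (post_exact (A := E (2 * m)) (dist_rot (dist_rot dq)) _).2.
by exists v.
Qed.

(** A degree q - p with a nonzero map is bounded below by [bounded_sphere], so a least
    one exists. The natural number that is minimized is v = q + L - p. *)
Lemma exists_low_map X : ~ is_zero X -> exists p q (f : @Hom P (S^p s) (S^q X)),
  f <> 0 /\ forall p' q', (q' + p < p')%N -> @hom0 P (S^p' s) (S^q' (S^q X)).
Proof.
move=> X_nz.
have [p0 [q0 nz0]] : exists p q, ~ @hom0 P (S^p s) (S^q X).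
  apply: contrapT => no; apply: X_nz.
  apply: (s_gen X (thick_hom0_l T X) _ 0%N 0%N (idm X)) => p q.
  by apply: contrapT => nz; apply: no; exists p, q.
have [L [D h]] := bounded_sphere X.
have low p q : (L <= q)%N -> (q + L <= p)%N -> @hom0 P (S^p s) (S^q X).
  by move=> Lq qp; apply/hdim_le0; have := h p q Lq; rewrite /sphere_gap qp.
pose Q v := `[< exists p q, [/\ L <= q, q + L = p + v & ~ @hom0 P (S^p s) (S^q X)] >]%N.
have exQ : exists v, Q v.
  have nzL : ~ @hom0 P (S^(L + p0) s) (S^(L + q0) X).
    by rewrite !iterD; move/hom0_iter.
  exists (L + q0 + L - (L + p0))%N; apply/asboolP; exists (L + p0)%N, (L + q0)%N.
  split=> //; first by lia.
  have [le|lt] := leqP (L + q0 + L) (L + p0); last by lia.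
  by case: nzL; apply: low => //; lia.
case: (ex_minnP exQ) => v /asboolP[p [q [Lq vE nz]]] vmin.
have [f f_nz] : exists f : @Hom P (S^p s) (S^q X), f <> 0.
  apply: contrapT => no; apply: nz => f; apply: contrapT => fnz.
  by apply: no; exists f.
exists p, q, f; split=> // p' q' lt; rewrite -iterD; apply: contrapT => nz'.
have [le|lt'] := leqP (q' + q + L) p'; first by apply: nz'; apply: low => //; lia.
suff /vmin : Q (q' + q + L - p')%N by lia.
by apply/asboolP; exists p', (q' + q)%N; split=> //; lia.
Qed.

(** Induction on a bound for the total dimension: replacing X by the cone Z of a low
    map lowers it by one, while [X] and [Z] differ by a sign and a multiple of [s]. *)
Lemma K0_class_generated X : exists c, K0_class T X = K0_class T s *~ c.
Proof.
have [N] := window_sum_bounded X.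
elim: N X => [|N IHN] X bX.
all: have [X0|X_nz] := pselect (is_zero X); first by exists 0; rewrite K0_class_zero.
all: have [p [q [f [f_nz low]]]] := exists_low_map X_nz.
all: have [Z [g [h d]]] := tr1_cone T f.
all: have dim_Z := eventually_and (eventually_and bX (window_sum_iter q X))
  (cone_drop d f_nz low).
  have [M hM] := dim_Z; have [[b e1] e2] := hM M (leqnn M).
  have : 0 <= window_sum 1 M Z.
    by apply: sumr_ge0 => r _; rewrite expr1n mul1r.
  by lia.
have [|c Zc] := IHN Z.
  by apply: eventually_mono dim_Z => m [[b e1] e2]; lia.
have Xq : K0_class T X = K0_class T (S^q X) *~ (-1) ^+ q.
  by rewrite K0_class_iter -mulrzA -expr2 sqrr_sign.
rewrite Xq (K0_class_dist d) Zc K0_class_iter -mulrzDr -mulrzA.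
by eexists.
Qed.

Lemma K0_isomorphic_Z : exists f : {additive K0 T -> int}, bijective f.
Proof.
apply: (K0_infinite_cyclic K0_class_generated).
apply: (K0_class_infinite_order (chi := window_sum (-1))).
- exact: window_sum_biproduct.
- exact: window_sum_dist.
- by apply: window_sum_sphere; rewrite sqrrN expr1n.
Qed.

End Invariants.

Theorem theorem4p1 (n : nat) (hn : (1 <= n)%N) (k : closedFieldType)
    (C : linear_triangulated k) (hC : is_cluster_cat_Ainf n C) :
  exists f : {additive K0 (lt_tri C) -> int}, bijective f.
Proof.
have [_ _ [s [sph gen]]] := hC.
have s_lines := spherical_two_lines sph.
have [E [E0 E_lines E_step]] := tower_exists hn s_lines.
exact: K0_isomorphic_Z hn s_lines gen E0 E_lines E_step.
Qed.
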